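(* In the standing setup, for any full rate linear dispersive code (full rank $\mathbf G$) with multiplexing gain $r\in[0,n_t]$ and diversity gain $d(r)$, the SD complexity exponent satisfies $c(r)\le\bar c(r)$, where $$\bar c(r)=\max_{\boldsymbol\alpha\in\mathbb R^{n_t}}\ \sum_{i=1}^{n_t}T\min\Big(\frac{r}{n_t}-1+\alpha_i,\ \frac{r}{n_t}\Big)^{+}$$ subject to $\sum_{i=1}^{n_t}(n_r-n_t+2i-1)\alpha_i\le d(r)$ and $\alpha_1\ge\alpha_2\ge\dots\ge\alpha_{n_t}\ge0$.
   Context: $(a)^+=\max(a,0)$. Standing setup. Let $\rho>0$ (SNR) tend to infinity; $\log$ is base 2. For functions of $\rho$, $f(\rho)\doteq\rho^a$ means $\lim_{\rho\to\infty}\log f(\rho)/\log\rho=a$. Channel: $\mathbf Y=\mathbf H\mathbf X+\mathbf W$ with $\mathbf H\in\mathbb C^{n_r\times n_t}$ ($n_r\ge n_t$) having i.i.d. $\mathcal{CN}(0,1)$ entries, $\mathbf W\in\mathbb C^{n_r\times T}$ with i.i.d. $\mathcal{CN}(0,1)$ entries, independent of $\mathbf H$ and of the codeword. Full rate linear dispersive code: $\kappa=n_tT$, $\mathbf X=\theta\sum_{i=1}^\kappa s_i\mathbf D_i$ with linearly independent $\mathbf D_i\in\mathbb C^{n_t\times T}$, symbols $s_i$ drawn i.i.d. uniformly from $\mathcal Q_\eta=\{s\in\mathbb C:\Re s,\Im s\in\mathbb Z\cap[-\eta,\eta]\}$. The generator matrix is $\mathbf G=[\mathrm{vec}(\mathbf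 D_1)\cdots\mathrm{vec}(\mathbf D_\kappa)]\in\mathbb C^{\kappa\times\kappa}$ (full rank), so $\mathrm{vec}(\mathbf X)=\theta\mathbf G\mathbf s$. For multiplexing gain $r\in[0,n_t]$, $\eta\doteq\rho^{rT/(2\kappa)}$ and $\theta^2\doteq\rho^{1-rT/\kappa}$. The diversity gain is $d(r)=-\lim_{\rho\to\infty}\log\Pr(\hat{\mathbf X}_{\mathrm{ML}}\ne\mathbf X)/\log\rho$ with $\hat{\mathbf X}_{\mathrm{ML}}=\arg\min_{\mathbf X'}\|\mathbf Y-\mathbf H\mathbf X'\|_F^2$ over the codebook. Sphere decoder: $\mathbf M=\theta(\mathbf I_T\otimes\mathbf H)\mathbf G$, thin QR decomposition $\mathbf M=\mathbf Q\mathbf R$, $\mathbf r=\mathbf Q^H\mathrm{vec}(\mathbf Y)$; $\mathbf r_k$ = last $k$ entries of $\mathbf r$, $\mathbf R_k$ = lower-right $k\times k$ block of $\mathbf R$; $N_k=|\{\hat{\mathbf s}_k\in\mathcal Q_\eta^k:\|\mathbf r_k-\mathbf R_k\hat{\mathbf s}_k\|^2\le\xi^2\}|$, $N=\sum_{k=1}^\kappa N_k$, with radius $\xi^2=z\log\rho$, $z>d(r)$ constant. $\Psi(x)=-\lim_{\rho\to\infty}\log\Pr(N\ge\rho^x)/\log\rho$ and SD complexity exponent $c(r)=\inf\{x:\Psi(x)>d(r)\}$ (limits assumed to exist). *)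

(* Defs.v *)
(* MathComp + MathComp-Analysis (R : realType), complex numbers R[i]
   from mathcomp-real-closed. *)
From HB Require Import structures.
From mathcomp Require Import all_boot all_order all_algebra.
From mathcomp Require Import all_classical all_reals all_analysis.
From mathcomp Require Import complex.
Set Implicit Arguments. Unset Strict Implicit. Unset Printing Implicit Defensive.
Import Order.TTheory GRing.Theory Num.Theory.
Import numFieldNormedType.Exports.
Local Open Scope classical_set_scope.
Local Open Scope ring_scope.

Section SDdefs.
Variable R : realType.
Local Notation C := (R[i]).

(* ---------- asymptotics ---------- *)

(* f(rho) \doteq rho^a : lim_{rho -> oo} log f(rho) / log rho = a
   (log requires f(rho) > 0, at least eventually). *)
Definition dot_eq (f : R -> R) (a : R) : Prop :=
  (\forall rho \near +oo%R, 0 < f rho) /\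
  ((fun rho => ln (f rho) / ln rho) @ +oo%R --> a).

(* rho |-> - log p(rho) / log rho, with the convention - log 0 = +oo
   (probabilities are >= 0). *)
Definition negexpo (p : R -> R) : R -> \bar R :=
  fun rho => if 0 < p rho then ((- ln (p rho)) / ln rho)%:E else +oo%E.

(* ---------- complex linear algebra ---------- *)

Definition cabs2 (z : C) : R := complex.Re z ^+ 2 + complex.Im z ^+ 2.

(* squared Frobenius norm *)
Definition frob2 m n (A : 'M[C]_(m, n)) : R := \sum_i \sum_j cabs2 (A i j).

(* conjugate transpose *)
Definition ctr m n (A : 'M[C]_(m, n)) : 'M[C]_(n, m) :=
  (map_mx (fun z : C => z^*) A)^T.

(* column-stacking vectorisation vec : C^{m x n} -> C^{n m}: entry (i,t) of A
   sits at position t*m + i (= mxvec_index t i of A^T). *)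
Definition vecc m n (A : 'M[C]_(m, n)) : 'cV[C]_(n * m) := (mxvec A^T)^T.

(* the Kronecker product I_T (x) H, indexed consistently with vecc *)
Definition kronI (T nr nt : nat) (H : 'M[C]_(nr, nt)) : 'M[C]_(T * nr, T * nt) :=
  \matrix_(k, l)
    let ti := enum_val (cast_ord (esym (@mxvec_cast T nr)) k) in
    let uj := enum_val (cast_ord (esym (@mxvec_cast T nt)) l) in
    if ti.1 == uj.1 then H ti.2 uj.2 else 0.

(* thin QR decomposition M = Q R: Q has orthonormal columns, R is square upper
   triangular *)
Definition thinQR m n (M : 'M[C]_(m, n)) (QR : 'M[C]_(m, n) * 'M[C]_n) : Prop :=
  [/\ ctr QR.1 *m QR.1 = 1%:M, M = QR.1 *m QR.2 &
      forall i j : 'I_n, (j < i)%N -> QR.2 i j = 0].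

(* ---------- constellation Q_eta ---------- *)

(* index type of Q_eta = {a + b i : a, b in Z cap [-eta, eta]} *)
Definition QI (eta : nat) : finType := ('I_(eta.*2.+1) * 'I_(eta.*2.+1))%type.

Definition qval (eta : nat) (a : QI eta) : C :=
  Complex ((a.1 : nat)%:R - eta%:R) ((a.2 : nat)%:R - eta%:R).

Definition qdef (eta : nat) : QI eta := (ord0, ord0).

(* ---------- the code ---------- *)

(* kappa = n_t T *)
Definition kappa (nt T : nat) : nat := (T * nt)%N.

(* generator matrix G = [vec D_1 ... vec D_kappa] *)
Definition ldc_gen (nt T : nat) (D : 'I_(kappa nt T) -> 'M[C]_(nt, T)) :
  'M[C]_(kappa nt T) := \matrix_(j, i) vecc (D i) j 0.

(* codeword X = theta * sum_i s_i D_i *)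
Definition codeword (nt T : nat) (D : 'I_(kappa nt T) -> 'M[C]_(nt, T))
  (eta : nat) (theta : R) (s : {ffun 'I_(kappa nt T) -> QI eta}) : 'M[C]_(nt, T) :=
  (Complex theta 0 : C) *: \sum_i qval (s i) *: D i.

(* ML decoding error (ties counted as errors): some codeword different from
   the transmitted one has metric no larger than the transmitted one *)
Definition ml_error (nr nt T : nat) (D : 'I_(kappa nt T) -> 'M[C]_(nt, T))
  (eta : nat) (theta : R) (H : 'M[C]_(nr, nt)) (W : 'M[C]_(nr, T))
  (s : {ffun 'I_(kappa nt T) -> QI eta}) : Prop :=
  let Y := H *m codeword D theta s + W in
  exists s' : {ffun 'I_(kappa nt T) -> QI eta},
    codeword D theta s' != codeword D theta s /\
    frob2 (Y - H *m codeword D theta s') <= frob2 (Y - H *m codeword D theta s).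

(* ---------- sphere decoder complexity ---------- *)

Definition QRfun (m n : nat) := 'M[C]_(m, n) -> 'M[C]_(m, n) * 'M[C]_n.

(* || r_k - R_k \hat s_k ||^2 with r_k the last k entries of r and R_k the
   lower-right k x k block of R *)
Definition partial_metric (n k : nat) (r : 'cV[C]_n) (Rm : 'M[C]_n)
  (eta : nat) (sk : k.-tuple (QI eta)) : R :=
  \sum_(i : 'I_n | (n - k <= i)%N)
     cabs2 (r i 0 - \sum_(j : 'I_n | (n - k <= j)%N)
                       Rm i j * qval (nth (qdef eta) sk (j - (n - k)))).

(* N = sum_{k=1}^{kappa} N_k, radius xi^2 *)
Definition sd_count (nr nt T : nat) (qr : QRfun (T * nr) (kappa nt T))
  (D : 'I_(kappa nt T) -> 'M[C]_(nt, T)) (eta : nat) (theta : R) (xi2 : R)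
  (H : 'M[C]_(nr, nt)) (W : 'M[C]_(nr, T))
  (s : {ffun 'I_(kappa nt T) -> QI eta}) : nat :=
  let Y := H *m codeword D theta s + W in
  let M := (Complex theta 0 : C) *: (kronI T H *m ldc_gen D) in
  let Q := (qr M).1 in
  let Rm := (qr M).2 in
  let r := ctr Q *m vecc Y in
  \sum_(1 <= k < (kappa nt T).+1)
     #|[set sk : k.-tuple (QI eta) | (partial_metric r Rm sk <= xi2)%R]|.

(* ---------- probability ---------- *)

(* real coordinates (Re, Im) of the entries of H (inl) and W (inr) *)
Definition gcoord (nr nt T : nat) (H : 'M[C]_(nr, nt)) (W : 'M[C]_(nr, T))
  (g : ('I_nr * 'I_nt * bool) + ('I_nr * 'I_T * bool)) : R :=
  match g with
  | inl (i, j, b) => if b then complex.Re (H i j) else complex.Im (H i j)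
  | inr (i, j, b) => if b then complex.Re (W i j) else complex.Im (W i j)
  end.

(* H and W have i.i.d. CN(0,1) entries, H independent of W: all the real
   coordinates are measurable, mutually independent, and N(0, 1/2). *)
Definition iid_CN01 d (Omega : measurableType d) (P : probability Omega R)
  (nr nt T : nat) (H : Omega -> 'M[C]_(nr, nt)) (W : Omega -> 'M[C]_(nr, T)) : Prop :=
  [/\ forall g, measurable_fun setT (fun w => gcoord (H w) (W w) g),
      forall g (B : set R), measurable B ->
        P ((fun w => gcoord (H w) (W w) g) @^-1` B) =
        normal_prob 0 (Num.sqrt (2^-1)) B &
      forall B : ('I_nr * 'I_nt * bool) + ('I_nr * 'I_T * bool) -> set R,
        (forall g, measurable (B g)) ->
        P [set w | forall g, B g (gcoord (H w) (W w) g)] =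
        (\prod_g P ((fun w => gcoord (H w) (W w) g) @^-1` B g))%E].

(* probability of an event depending on the transmitted symbol vector s,
   s uniform on Q_eta^kappa and independent of (H, W) *)
Definition prob_s d (Omega : measurableType d) (P : probability Omega R)
  (k eta : nat) (E : {ffun 'I_k -> QI eta} -> set Omega) : R :=
  (#|{: {ffun 'I_k -> QI eta}}|%:R)^-1 *
  \sum_(s : {ffun 'I_k -> QI eta}) fine (P (E s)).

(* ---------- the bound \bar c(r) ---------- *)

Definition alpha_feasible (nr nt : nat) (dr : R) (alpha : 'I_nt -> R) : Prop :=
  [/\ \sum_(i < nt) ((nr%:R - nt%:R + 2 * (i.+1)%:R - 1) * alpha i) <= dr,
      forall i j : 'I_nt, (i <= j)%N -> alpha j <= alpha i &
      forall i, 0 <= alpha i].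

Definition cbar (nr nt T : nat) (r dr : R) : R :=
  sup [set v | exists alpha : 'I_nt -> R, @alpha_feasible nr nt dr alpha /\
        v = \sum_(i < nt) T%:R *
              Num.max (Num.min (r / nt%:R - 1 + alpha i) (r / nt%:R)) 0].

End SDdefs.

(* Main.v *)
(* Fix x > cbar. Since the number of lattice points in a ball is bounded uniformly
   in its centre, only H matters. Gaussian elimination on H with complete pivoting
   gives coordinates in which N is bounded in terms of the pivots alone: if the
   squared pivots are rho^(-a_k), then N <= rho^(sum_k T min(r/nt - 1 + a_k, r/nt)^+)
   up to subpolynomial factors. Conversely, when
   pivot k is at most eps_k, the entry (i, j) of H (in pivoted order) lies within
   O(eps_min(i,j)) of a function of the entries eliminated before it, so bounded
   Gaussian densities and independence give probability O(prod eps_k^(2 (nr + nt - 2k - 1))),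
   k from 0, which is rho^(-sum (nr - nt + 2i - 1) alpha_i) for alpha_i = a_(nt - i).
   A union bound over a finite grid of exponents leaves only feasible alpha. *)
Require Import Defs.
From HB Require Import structures.
From mathcomp Require Import all_boot all_order all_algebra.
From mathcomp Require Import all_classical all_reals all_analysis.
From mathcomp Require Import perm complex.
From mathcomp Require Import measurable_realfun.
From mathcomp Require Import ring lra zify.
Set Implicit Arguments. Unset Strict Implicit. Unset Printing Implicit Defensive.
Import Order.TTheory GRing.Theory Num.Theory.
Import numFieldNormedType.Exports.
Local Open Scope classical_set_scope.
Local Open Scope ring_scope.

(** Singular values of H would be the natural parameters, but they require their joint density. A
    pivot needs only independence and a bounded density: under complete pivoting a small pivot
    forces the whole remaining block to be small, so step k constrains every entry of its row and
    column. The price is a random pair of permutations, absorbed by a union bound over finitely many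
    pairs, and constants depending only on the dimensions and the code, invisible in exponents. The
    min in the program reflects two ways to count a complex coordinate: by cells of a box of
    half-side proportional to xi / (theta pivot_k), or, once a_k > 1 makes that box larger than the
    constellation, by symbols, (2 eta + 1)^2 of them, about rho^(r/nt). Mixing the two requires that
    |F| unconfined coordinates cost only |F| symbols, which a well chosen set of rows ensures. Since
    c(r) asks for Psi(x) strictly above d(r), the probability bound must beat d(r) by some e > 0;
    the value of the program moves by at most a multiple of e when its budget does. *)

Local Notation normc := ComplexField.Normc.normc.

(** * Modulus of complex numbers *)

Section Modulus.
Variable R : realType.
Implicit Types x y : R[i].

Lemma normc_ge0 x : 0 <= normc x.
Proof. by case: x => a b; exact: sqrtr_ge0. Qed.

Lemma normc_gt0 x : x != 0 -> 0 < normc x.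
Proof.
move=> x0; rewrite lt_neqAle normc_ge0 andbT eq_sym.
by apply: contra x0 => /eqP/ComplexField.Normc.eq0_normc ->.
Qed.

Lemma normcD x y : normc (x + y) <= normc x + normc y.
Proof. exact: le_normcD. Qed.

Lemma normcB x y : normc (x - y) <= normc x + normc y.
Proof. by rewrite -(normcN y); exact: normcD. Qed.

Lemma normc_sum (I : Type) (s : seq I) (Q : pred I) (F : I -> R[i]) :
  normc (\sum_(i <- s | Q i) F i) <= \sum_(i <- s | Q i) normc (F i).
Proof.
elim/big_ind2 : _ => [|a b c d ab cd|//]; first by rewrite ComplexField.Normc.normc0.
by apply: le_trans (normcD _ _) _; exact: lerD.
Qed.

Lemma normc_cabs2 x : normc x ^+ 2 = cabs2 x.
Proof. by case: x => a b; rewrite /= sqr_sqrtr ?addr_ge0 ?sqr_ge0. Qed.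

Lemma Re_le_normc x : `|complex.Re x| <= normc x.
Proof.
rewrite -(@ler_pXn2r _ 2) ?nnegrE ?normr_ge0 ?normc_ge0//.
by rewrite normc_cabs2 /cabs2 real_normK ?num_real// lerDl sqr_ge0.
Qed.

Lemma Im_le_normc x : `|complex.Im x| <= normc x.
Proof.
rewrite -(@ler_pXn2r _ 2) ?nnegrE ?normr_ge0 ?normc_ge0//.
by rewrite normc_cabs2 /cabs2 real_normK ?num_real// lerDr sqr_ge0.
Qed.

Lemma normc_le_ReIm x : normc x <= `|complex.Re x| + `|complex.Im x|.
Proof.
rewrite -(@ler_pXn2r _ 2) ?nnegrE ?addr_ge0 ?normr_ge0 ?normc_ge0//.
rewrite normc_cabs2 /cabs2 sqrrD !real_normK ?num_real// -addrA lerD2l lerDr.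
by rewrite mulrn_wge0// mulr_ge0.
Qed.

End Modulus.

(** * Counting lattice points confined in only some of their coordinates *)

Section LatticeCount.
Variable R : realType.
Local Notation C := (R[i]).

(* Gaussian elimination with complete pivoting: all multipliers have modulus
   at most 1, so no conditioning assumption on B is needed. *)
Lemma bounded_row_basis (I K : finType) (F : {set K}) (B : I -> K -> C) :
  exists J : {set I}, (#|J| <= #|F|)%N /\
    forall (z : K -> C) (delta : R), 0 <= delta ->
      (forall i, i \in J -> normc (\sum_(k in F) B i k * z k) <= delta) ->
      forall i, normc (\sum_(k in F) B i k * z k) <= 3 ^+ #|F| * delta.
Proof.
move eqn : #|F| => n; elim: n F eqn B => [|n IHn] F Fn B.
  exists finset.set0; rewrite cards0; split => // z dl dl0 _ i.
  by rewrite (cards0_eq Fn) big_set0 ComplexField.Normc.normc0 mulr_ge0 ?exprn_ge0.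
have [B0|] := pselect (forall i k, k \in F -> B i k = 0).
  exists finset.set0; rewrite cards0; split => // z dl dl0 _ i.
  rewrite big1 ?ComplexField.Normc.normc0 ?mulr_ge0 ?exprn_ge0//.
  by move=> k kF; rewrite B0// mul0r.
move=> /existsNP[i1 /existsNP[k1 /not_implyP[k1F /eqP B1]]].
have : (i1, k1).2 \in F by [].
move=> /(@arg_maxP _ _ _ (i1, k1) (fun p : I * K => p.2 \in F)
   (fun p => normc (B p.1 p.2))) [[i0 k0]] /= k0F Bmax.
have B00 : B i0 k0 != 0.
  apply/eqP => B00; have := Bmax (i1, k1) k1F; rewrite B00 ComplexField.Normc.normc0 /=.
  by apply/negP; rewrite -ltNge normc_gt0.
pose m i := B i k0 / B i0 k0.
have m1 i : normc (m i) <= 1.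
  rewrite /m ComplexField.Normc.normcM ComplexField.Normc.normcV.
  by rewrite ler_pdivrMr ?normc_gt0// mul1r; exact: (Bmax (i, k0)).
have [|J [Jn HJ]] := IHn (F :\ k0) _ (fun i k => B i k - m i * B i0 k).
  by move: Fn; rewrite (cardsD1 k0) k0F => -[].
exists (i0 |: J); split.
  by rewrite cardsU1; apply: leq_trans (leq_add (leq_b1 _) Jn) _; rewrite add1n.
move=> z dl dl0 Hz.
have E i : \sum_(k in F :\ k0) (B i k - m i * B i0 k) * z k =
    \sum_(k in F) B i k * z k - m i * \sum_(k in F) B i0 k * z k.
  rewrite mulr_sumr -sumrB [RHS](big_setD1 k0)//= /m mulrA divfK// subrr add0r.
  by apply: eq_bigr => k _; rewrite mulrBl mulrA.
have H0 : normc (\sum_(k in F) B i0 k * z k) <= dl by apply: Hz; rewrite setU11.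
have Hm i : normc (m i * \sum_(k in F) B i0 k * z k) <= dl.
  rewrite ComplexField.Normc.normcM -[leRHS]mul1r; apply: ler_pM => //; exact: normc_ge0.
have {}HJ i : normc (\sum_(k in F :\ k0) (B i k - m i * B i0 k) * z k)
    <= 3 ^+ n * (2 * dl).
  apply: HJ => [|j jJ]; first by rewrite mulr_ge0.
  rewrite E; apply: le_trans (normcB _ _) _; rewrite mulrDl mul1r; apply: lerD => //.
  by apply: Hz; rewrite setU1r.
move=> i.
have -> : \sum_(k in F) B i k * z k =
    \sum_(k in F :\ k0) (B i k - m i * B i0 k) * z k + m i * \sum_(k in F) B i0 k * z k.
  by rewrite E subrK.
apply: le_trans (normcD _ _) _.
apply: le_trans (lerD (HJ i) (Hm i)) _.
(* The recurrence is 2 * 3^n + 1 <= 3^(n+1): a reduced row is a row minus a multiple of the pivot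
   row, hence at most 2 [dl] on [J], and adding that multiple back costs one more [dl]. *)
have : 1 <= 3 ^+ n :> R by rewrite exprn_ege1// ler1n.
by rewrite exprS => h; nra.
Qed.

Lemma card_le_codes (X L : finType) (f : L -> X -> nat) (M : L -> nat) (V : {set X}) :
  (forall l v, v \in V -> (f l v < M l)%N) ->
  (forall v v', v \in V -> v' \in V -> (forall l, f l v = f l v') -> v = v') ->
  (#|V| <= \prod_l M l)%N.
Proof.
move=> fM inj; rewrite -big_enum /=; set s := enum L.
have {}inj v v' : v \in V -> v' \in V -> (forall l, l \in s -> f l v = f l v') -> v = v'.
  by move=> vV v'V h; apply: inj => // l; apply: h; rewrite mem_enum.
elim: s V fM inj => [|l s IHs] V fM inj.
  rewrite big_nil; have [->|[v vV]] := set_0Vmem V; first by rewrite cards0.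
  rewrite -(cards1 v) subset_leq_card//; apply/fintype.subsetP => v' v'V.
  by rewrite inE; apply/eqP; exact: inj.
rewrite big_cons.
have -> : #|V| = (\sum_(c < M l) #|[set v in V | f l v == c :> nat]|)%N.
  (* An empty [V] is treated apart: only a member of [V] shows that [M l] is positive, as [inord]
     requires. *)
  rewrite -sum1_card; have [->|[v0 v0V]] := set_0Vmem V.
    rewrite big_set0 big1// => c _; apply/eqP; rewrite cards_eq0.
    by apply/eqP/finset.setP => v; rewrite !inE.
  have Ml : (0 < M l)%N by apply: leq_ltn_trans (fM l v0 v0V).
  case: (M l) Ml (fM l) => // Ml _ fMl.
  rewrite (partition_big (fun v => inord (f l v) : 'I_Ml.+1) predT)//=.
  apply: eq_bigr => c _; rewrite -sum1_card; apply: eq_bigl => v; rewrite inE.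
  case: (boolP (v \in V)) => //= vV; rewrite -val_eqE /= inordK//; exact: fMl.
rewrite -[X in (_ <= X * _)%N]card_ord -sum_nat_const; apply: leq_sum => c _.
apply: IHs => [k v|v v']; first by rewrite inE => /andP[vV _]; exact: fM.
rewrite !inE => /andP[vV /eqP vc] /andP[v'V /eqP v'c] h.
by apply: inj => // k; rewrite inE => /orP[/eqP->|]; [rewrite vc v'c|exact: h].
Qed.

Lemma qval_near (eta : nat) (a b : QI eta) : normc (qval R a - qval R b) < 1 -> a = b.
Proof.
have natlt1 (m n : nat) : `|(m%:R - n%:R : R)| < 1 -> m = n.
  move=> h; apply/eqP; rewrite eqn_leq; move: h; rewrite ltr_norml => /andP[h1 h2].
  by rewrite -ltnS -[(n <= m)%N]ltnS -!(ltr_nat R) -!natr1; apply/andP; split; lra.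
case: a b => [a1 a2] [b1 b2] h; congr pair; apply/val_inj/natlt1.
  by apply: le_lt_trans h; apply: le_trans (Re_le_normc _); rewrite /= opprB addrA subrK.
by apply: le_lt_trans h; apply: le_trans (Im_le_normc _); rewrite /= opprB addrA subrK.
Qed.

Lemma same_cell (rho c x y : R) : 0 < c -> - rho <= x -> - rho <= y ->
  Num.truncn ((x + rho) / c) = Num.truncn ((y + rho) / c) -> `|x - y| <= c.
Proof.
move=> c0 hx hy e.
have hx' : 0 <= (x + rho) / c by apply: divr_ge0; lra.
have hy' : 0 <= (y + rho) / c by apply: divr_ge0; lra.
have /andP[x1 x2] := truncn_itv hx'; have /andP[y1 y2] := truncn_itv hy'.
move: x1 x2 y1 y2; rewrite e; set n := Num.truncn _.
rewrite -natr1 !ler_pdivlMr// !ltr_pdivrMr// => x1 x2 y1 y2.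
by rewrite ler_norml; apply/andP; split; lra.
Qed.

(** Small enough that two points with equal codes have symbols at distance below 1, hence equal:
    cells of width c leave an error of at most (3^|F| + 1) K C0 2c, which this width keeps under 1.
    The shifts [K.+1] and [1 + C0] keep it positive in degenerate cases. *)
Definition cell_width (C0 : R) (K : nat) : R := (8 * 3 ^+ K * K.+1%:R * (1 + C0))^-1.

Lemma cell_width_gt0 (C0 : R) (K : nat) : 0 <= C0 -> 0 < cell_width C0 K.
Proof. by move=> C00; rewrite invr_gt0 !mulr_gt0 ?exprn_gt0 ?ltr_wpDr. Qed.

(* A point is encoded by the cells of its bounded coordinates y_k, k \notin F,
   together with its symbols on a bounded row basis of the columns in F. *)
Lemma lattice_count (I K X : finType) (V : {set X}) (eta : nat) (s : X -> I -> QI eta)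
    (y : X -> K -> C) (A : I -> K -> C) (F : {set K}) (rho : K -> R) (C0 : R) :
  0 <= C0 -> (forall i k, normc (A i k) <= C0) ->
  (forall k, 0 <= rho k) ->
  (forall v k, v \in V -> k \notin F -> normc (y v k) <= rho k) ->
  (forall v v' i, v \in V -> v' \in V ->
     qval R (s v i) - qval R (s v' i) = \sum_k A i k * (y v k - y v' k)) ->
  (forall v v', v \in V -> v' \in V -> (forall i, s v i = s v' i) -> v = v') ->
  #|V|%:R <= (\prod_(k in ~: F) (1 + 2 / cell_width C0 #|K| * rho k)) ^+ 2 *
    (2 * eta%:R + 1) ^+ (2 * #|F|).
Proof.
move=> C00 AC rho0 yrho sy sinj; set c := cell_width _ _.
have c0 : 0 < c by exact: cell_width_gt0.
have [J [JF HJ]] := bounded_row_basis F A.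
pose L := ((K * bool) + (I * bool))%type.
pose part (b : bool) (z : C) := if b then complex.Re z else complex.Im z.
have part_le b z : `|part b z| <= normc z.
  by case: b; [exact: Re_le_normc|exact: Im_le_normc].
pose f (l : L) (v : X) : nat := match l with
  | inl (k, b) => if k \in F then 0%N else Num.truncn ((part b (y v k) + rho k) / c)
  | inr (i, b) => if i \in J then (if b then (s v i).1 : nat else (s v i).2 : nat) else 0%N end.
pose M (l : L) : nat := match l with
  | inl (k, b) => if k \in F then 1%N else (Num.truncn (2 / c * rho k)).+1
  | inr (i, b) => if i \in J then eta.*2.+1 else 1%N end.
have part_ge v k b : v \in V -> k \notin F -> - rho k <= part b (y v k) <= rho k.
  by move=> vV kF; rewrite -ler_norml; apply: le_trans (part_le _ _) _; exact: yrho.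
have : (#|V| <= \prod_l M l)%N.
  apply: (@card_le_codes _ _ f).
    move=> [[k b]|[i b]] v vV /=.
      case: ifPn => // kF; rewrite ltnS; apply: le_truncn.
      have /andP[h1 h2] := part_ge v k b vV kF.
      by rewrite ler_pdivrMr// mulrAC divfK ?gt_eqF//; lra.
    by case: ifP => // _; case: b.
  move=> v v' vV v'V h; apply: sinj => // i; apply: qval_near.
  have near k : k \notin F -> normc (y v k - y v' k) <= 2 * c.
    move=> kF; apply: le_trans (normc_le_ReIm _) _; rewrite mulrDl mul1r.
    have cell b : `|part b (y v k) - part b (y v' k)| <= c.
      have := h (inl (k, b)); rewrite /f (negbTE kF).
      have /andP[h1 _] := part_ge v k b vV kF.
      by have /andP[h2 _] := part_ge v' k b v'V kF; apply: same_cell.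
    have := lerD (cell true) (cell false); rewrite /part.
    by case: (y v k) (y v' k) => [a1 a2] [b1 b2].
  pose dl := #|K|%:R * (C0 * (2 * c)).
  have dl0 : 0 <= dl by rewrite !mulr_ge0// ltW.
  have bnd j : normc (\sum_(k in ~: F) A j k * (y v k - y v' k)) <= dl.
    apply: le_trans (normc_sum _ _ _) _.
    have -> : dl = \sum_(k : K) C0 * (2 * c) by rewrite sumr_const /dl mulr_natl.
    rewrite [leRHS](bigID (mem (~: F)))/= -[leLHS]addr0 lerD//; last first.
      by apply: sumr_ge0 => k _; rewrite !mulr_ge0// ltW.
    apply: ler_sum => k; rewrite inE => kF; rewrite ComplexField.Normc.normcM.
    by apply: ler_pM; rewrite ?normc_ge0// near.
  have split_sum j : qval R (s v j) - qval R (s v' j) =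
      \sum_(k in F) A j k * (y v k - y v' k) + \sum_(k in ~: F) A j k * (y v k - y v' k).
    rewrite sy// (bigID (mem F))/=; congr (_ + _); apply: eq_bigl => k.
    by rewrite inE.
  (* On [J] the symbols coincide, so the [F] part of the row is the opposite of the part outside
     [F], which the cells bound by [dl]. The row basis then carries the bound to every row. *)
  have HF : forall j, j \in J -> normc (\sum_(k in F) A j k * (y v k - y v' k)) <= dl.
    move=> j jJ.
    have sj : s v j = s v' j.
      have := h (inr (j, true)); have := h (inr (j, false)); rewrite /f jJ.
      by case: (s v j) (s v' j) => [a1 a2] [b1 b2] /= e1 e2; congr pair; apply: val_inj.
    have := split_sum j; rewrite sj subrr => /esym/eqP; rewrite addr_eq0 => /eqP ->.
    by rewrite normcN.
  rewrite split_sum; apply: le_lt_trans (normcD _ _) _.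
  apply: le_lt_trans (lerD (HJ _ _ dl0 HF i) (bnd i)) _.
  have e3 : 3 ^+ #|F| <= 3 ^+ #|K| :> R by rewrite ler_weXn2l ?ler1n// max_card.
  have e1 : 1 <= 3 ^+ #|K| :> R by rewrite exprn_ege1// ler1n.
  apply: (@le_lt_trans _ _ (2 * 3 ^+ #|K| * dl)); first by nra.
  rewrite /dl /c /cell_width.
  set D := _ * _ * _ * (1 + C0).
  have D0 : 0 < D by rewrite /D !mulr_gt0 ?exprn_gt0 ?ltr_wpDr.
  have -> : 2 * 3 ^+ #|K| * (#|K|%:R * (C0 * (2 * D^-1))) =
            (4 * 3 ^+ #|K| * #|K|%:R * C0) / D by field; rewrite gt_eqF.
  rewrite ltr_pdivrMr// mul1r /D -natr1.
  have K0 : 0 <= #|K|%:R :> R by [].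
  set a := _ ^+ _ in e1 *; set k := _%:R in K0 *.
  have ak : 0 <= a * k by rewrite mulr_ge0//; lra.
  have : 0 <= a * k * C0 by rewrite mulr_ge0.
  have : 0 <= a * C0 by rewrite mulr_ge0//; lra.
  by nra.
rewrite -(ler_nat R) => /le_trans; apply.
rewrite natr_prod big_sumType /=; apply: ler_pM.
- by apply: prodr_ge0.
- by apply: prodr_ge0.
- rewrite (_ : \prod_p _ = \prod_(k : K) \prod_(b : bool) (M (inl (k, b)))%:R);
    last by rewrite pair_bigA; apply: eq_bigr => -[].
  rewrite -prodrXl [leRHS]big_mkcond /=; apply: ler_prod => k _.
  apply/andP; split; first by apply: prodr_ge0.
  rewrite big_bool inE /=; case: ifPn => kF /=; first by rewrite mulr1.
  have le1 : (Num.truncn (2 / c * rho k)).+1%:R <= 1 + 2 / c * rho k.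
    rewrite -natr1 addrC lerD2l truncn_le mulr_ge0// divr_ge0// ltW//.
  by rewrite expr2; apply: ler_pM.
- rewrite (_ : \prod_p _ = \prod_(i : I) \prod_(b : bool) (M (inr (i, b)))%:R);
    last by rewrite pair_bigA; apply: eq_bigr => -[].
  apply: (@le_trans _ _ (\prod_(i in J) (2 * eta%:R + 1) ^+ 2)).
    rewrite [leRHS]big_mkcond /=; apply: ler_prod => i _.
    apply/andP; split; first by apply: prodr_ge0.
    rewrite big_bool /=; case: ifPn => iJ /=; last by rewrite mulr1.
    by rewrite expr2 -natr1 -muln2 natrM [2 * _]mulrC.
  rewrite prodr_const -exprM ler_weXn2l//; last by rewrite leq_mul2l.
  by rewrite -[leLHS]add0r lerD// mulr_ge0.
Qed.

End LatticeCount.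

(** * Gaussian elimination with complete pivoting *)

Section CompletePivoting.
Variable R : realType.
Local Notation C := (R[i]).
Implicit Types A : nat -> nat -> C.

(** The Schur complement after k elimination steps, meaningful for a, b >= k. As division by 0 gives
    0, a zero pivot leaves the entries unchanged. *)
Fixpoint schur A (k a b : nat) : C :=
  if k is k'.+1 then schur A k' a b - schur A k' a k' * schur A k' k' b / schur A k' k' k'
  else A a b.

Definition pivoted A (m n : nat) := forall k a b : nat,
  (k <= a < m)%N -> (k <= b < n)%N -> normc (schur A k a b) <= normc (schur A k k k).

(* Complete pivoting allows the pivots to grow by a factor 2 at each step;
   after rescaling they are nonincreasing. *)
Definition pivot A (k : nat) : R := normc (schur A k k k) / 2 ^+ k.

Lemma pivot_ge0 A k : 0 <= pivot A k.
Proof. by rewrite divr_ge0 ?normc_ge0 ?exprn_ge0. Qed.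

(** The first k steps single out only the rows and columns below k, so a later exchange does not
    disturb them. This makes the greedy choice of pivots possible. *)
Lemma schur_relabel A (p q : nat -> nat) k a b :
  (forall i, (i < k)%N -> p i = i) -> (forall i, (i < k)%N -> q i = i) ->
  schur (fun a b => A (p a) (q b)) k a b = schur A k (p a) (q b).
Proof.
elim: k a b => //= k IHk a b pk qk.
have e a' b' : schur (fun a b => A (p a) (q b)) k a' b' = schur A k (p a') (q b').
  by apply: IHk => i ik; [apply: pk|apply: qk]; exact: ltnW.
by rewrite !e (pk k)// (qk k).
Qed.

Lemma normc_schurS_le A m n k a b : pivoted A m n ->
  (k < a < m)%N -> (k < b < n)%N -> normc (schur A k.+1 a b) <= 2 * normc (schur A k k k).
Proof.
move=> Ap /andP[ka am] /andP[kb bn] /=.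
have kkm : (k <= k < m)%N by rewrite leqnn (ltn_trans ka).
have kkn : (k <= k < n)%N by rewrite leqnn (ltn_trans kb).
have kam : (k <= a < m)%N by rewrite ltnW.
have kbn : (k <= b < n)%N by rewrite ltnW.
apply: le_trans (normcB _ _) _; rewrite mulrDl mul1r lerD ?Ap//.
rewrite !ComplexField.Normc.normcM ComplexField.Normc.normcV.
have [->|u0] := eqVneq (schur A k k k) 0.
  by rewrite ComplexField.Normc.normc0 invr0 mulr0.
rewrite ler_pdivrMr ?normc_gt0//; apply: ler_pM; rewrite ?normc_ge0//; exact: Ap.
Qed.

Lemma pivot_nonincreasing A m n k l : pivoted A m n -> (n <= m)%N ->
  (k <= l < n)%N -> pivot A l <= pivot A k.
Proof.
move=> Ap nm /andP[]; elim: l => [|l IHl]; first by rewrite leqn0 => /eqP ->.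
rewrite leq_eqVlt => /predU1P[->//|kl ln]; apply: le_trans (IHl kl (ltnW ln)).
rewrite /pivot exprS invfM mulrA ler_pM2r ?invr_gt0 ?exprn_gt0// ler_pdivrMr//.
by rewrite mulrC; apply: normc_schurS_le Ap _ _; rewrite ltnSn// (leq_trans ln).
Qed.

Lemma normc_schur_le_pivot A m n k a b : pivoted A m n ->
  (k <= a < m)%N -> (k <= b < n)%N -> normc (schur A k a b) <= 2 ^+ k * pivot A k.
Proof. by move=> Ap ha hb; rewrite /pivot mulrC divfK ?expf_neq0// Ap. Qed.

(** Row a of step k.+1, applied to x, is row a of step k minus a multiple of row k, with multiplier
    of modulus at most 1; each step therefore at most doubles the residual. *)
Lemma elimination_residual_le A m n (x : nat -> C) (delta : R) :
  pivoted A m n -> (n <= m)%N -> (forall k, (k < n)%N -> schur A k k k != 0) ->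
  (forall a, (a < m)%N -> normc (\sum_(0 <= b < n) A a b * x b) <= delta) ->
  forall k a, (k < n)%N -> (k <= a < m)%N ->
    normc (\sum_(k <= b < n) schur A k a b * x b) <= 2 ^+ k * delta.
Proof.
move=> Ap nm u0 Ax; elim=> [|k IHk] a kn /andP[ka am].
  by rewrite expr0 mul1r; exact: Ax.
have kn' := ltnW kn; have ukk := u0 _ kn'.
have kkm : (k <= k < m)%N by rewrite leqnn (leq_trans kn').
have -> : \sum_(k.+1 <= b < n) schur A k.+1 a b * x b =
    \sum_(k <= b < n) schur A k a b * x b -
    schur A k a k / schur A k k k * \sum_(k <= b < n) schur A k k b * x b.
  rewrite mulr_sumr -sumrB [RHS]big_ltn// mulrA divfK// subrr add0r.
  by apply: eq_bigr => b _ /=; rewrite mulrBl; congr (_ - _); rewrite mulrA (mulrAC (schur A k a k)).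
apply: le_trans (normcB _ _) _.
have h1 : normc (\sum_(k <= b < n) schur A k a b * x b) <= 2 ^+ k * delta.
  by apply: IHk => //; rewrite ltnW.
have h2 := IHk k kn' kkm.
have h3 : normc (schur A k a k / schur A k k k) <= 1.
  rewrite ComplexField.Normc.normcM ComplexField.Normc.normcV ler_pdivrMr ?normc_gt0// mul1r.
  by apply: Ap; rewrite ?leqnn// ltnW.
rewrite exprS -[leRHS]mulrA [leRHS]mulr_natl mulr2n lerD// ComplexField.Normc.normcM -[leRHS]mul1r.
by apply: ler_pM => //; exact: normc_ge0.
Qed.

(** The vector U x, where A = L U with U unit upper triangular. These coordinates are confined one
    by one, each by its own pivot. *)
Definition elim_coord A (n : nat) (x : nat -> C) (k : nat) : C :=
  \sum_(k <= b < n) schur A k k b / schur A k k k * x b.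

(** The factor 2^k gained by the residual cancels against the rescaling built into [pivot]. *)
Lemma elim_coord_le A m n (x : nat -> C) (delta : R) :
  pivoted A m n -> (n <= m)%N -> (forall k, (k < n)%N -> schur A k k k != 0) ->
  (forall a, (a < m)%N -> normc (\sum_(0 <= b < n) A a b * x b) <= delta) ->
  forall k, (k < n)%N -> normc (elim_coord A n x k) <= delta / pivot A k.
Proof.
move=> Ap nm u0 Ax k kn; have ukk := normc_gt0 (u0 _ kn).
have -> : elim_coord A n x k =
    (schur A k k k)^-1 * \sum_(k <= b < n) schur A k k b * x b.
  by rewrite mulr_sumr; apply: eq_bigr => b _; rewrite mulrAC [RHS]mulrC.
rewrite ComplexField.Normc.normcM ComplexField.Normc.normcV /pivot invf_div.
rewrite mulrC ler_pdivrMr// mulrA divfK ?gt_eqF// [delta * _]mulrC.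
by apply: (elimination_residual_le Ap nm u0 Ax kn); rewrite leqnn (leq_trans kn).
Qed.

(** The inverse is built row by row from the bottom: a new row is a unit vector minus a combination,
    with coefficients of modulus at most 1, of at most n rows already known, so the bound grows by n
    + 1. It does not depend on [N], which later makes the count uniform in H. *)
Lemma back_substitution (N : nat -> nat -> C) (n : nat) :
  (forall i j, (i < j < n)%N -> normc (N i j) <= 1) ->
  exists E : nat -> nat -> C,
    (forall i k, normc (E i k) <= n.+1%:R ^+ n) /\
    forall (x : nat -> C) (i : nat), (i < n)%N ->
      x i = \sum_(0 <= k < n) E i k * (x k + \sum_(k.+1 <= j < n) N k j * x j).
Proof.
move=> N1.
suff /(_ n (leqnn n))[E [E1 Ex]] : forall d, (d <= n)%N -> exists E : nat -> nat -> C,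
    (forall i k, normc (E i k) <= n.+1%:R ^+ d) /\
    forall (x : nat -> C) (i : nat), (n - d <= i < n)%N ->
      x i = \sum_(0 <= k < n) E i k * (x k + \sum_(k.+1 <= j < n) N k j * x j).
  by exists E; split => // x i ilt; apply: Ex; rewrite subnn.
elim=> [|d IHd] dn.
  exists (fun _ _ => 0); split => [i k|x i]; first by rewrite ComplexField.Normc.normc0.
  by rewrite subn0 ltnNge andbN.
have [E [E1 Ex]] := IHd (ltnW dn).
pose r := (n - d.+1)%N; have rn : (r < n)%N by rewrite /r; lia.
pose e k : C := (r == k)%:R - \sum_(r.+1 <= j < n) N r j * E j k.
exists (fun i k => if i == r then e k else E i k); split.
  move=> i k; have E1' : normc (E i k) <= n.+1%:R ^+ d.+1.
    by apply: le_trans (E1 i k) _; rewrite ler_weXn2l// ler1n.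
  case: ifP => // _; apply: le_trans (normcB _ _) _.
  have h1 : normc (r == k)%:R <= n.+1%:R ^+ d :> R.
    apply: (@le_trans _ _ 1); last by rewrite exprn_ege1// ler1n.
    by case: (r == k); rewrite ?ComplexField.Normc.normc1 ?ComplexField.Normc.normc0.
  have h2 : normc (\sum_(r.+1 <= j < n) N r j * E j k) <= n%:R * n.+1%:R ^+ d.
    apply: le_trans (normc_sum _ _ _) _.
    apply: (@le_trans _ _ (\sum_(r.+1 <= j < n) n.+1%:R ^+ d)).
      rewrite big_nat [leRHS]big_nat; apply: ler_sum => j /andP[rj jn].
      rewrite ComplexField.Normc.normcM -[leRHS]mul1r.
      by apply: ler_pM; rewrite ?normc_ge0// N1// rj.
    rewrite sumr_const_nat -[leLHS]mulr_natl ler_pM2r ?exprn_gt0// ler_nat; lia.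
  by apply: le_trans (lerD h1 h2) _; rewrite exprS -[X in _ <= X * _]natr1 mulrDl mul1r addrC.
move=> x i /andP[ri ilt]; set y := fun k => x k + \sum_(k.+1 <= j < n) N k j * x j.
case: (eqVneq i r) => [->|ir]; last first.
  by apply: Ex; rewrite ilt andbT; move: ri ir; rewrite /r => ?/eqP?; lia.
transitivity (y r - \sum_(r.+1 <= j < n) N r j * x j); first by rewrite /y addrK.
rewrite /e; under [RHS]eq_bigr do rewrite mulrBl mulr_suml.
rewrite sumrB; congr (_ - _).
  rewrite (bigD1_seq r) ?mem_index_iota ?iota_uniq//= eqxx mul1r -/(y r) -[LHS]addr0; congr (_ + _); rewrite big1// => k kr.
  by rewrite eq_sym (negbTE kr) mul0r.
rewrite exchange_big /= big_nat [RHS]big_nat; apply: eq_bigr => j /andP[rj jn].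
rewrite (Ex x j); last by rewrite jn andbT; move: rj; rewrite /r; lia.
by rewrite mulr_sumr; apply: eq_bigr => k _; rewrite mulrA.
Qed.

Lemma elim_coord_inverse A m n : pivoted A m n -> (n <= m)%N ->
  (forall k, (k < n)%N -> schur A k k k != 0) ->
  exists E : nat -> nat -> C, (forall i k, normc (E i k) <= n.+1%:R ^+ n) /\
    forall (x : nat -> C) (i : nat), (i < n)%N ->
      x i = \sum_(0 <= k < n) E i k * elim_coord A n x k.
Proof.
move=> Ap nm u0.
have [|E [E1 Ex]] := @back_substitution (fun k b => schur A k k b / schur A k k k) n.
  move=> i j /andP[ij jn]; have ilt := ltn_trans ij jn.
  rewrite ComplexField.Normc.normcM ComplexField.Normc.normcV.
  rewrite ler_pdivrMr ?normc_gt0 ?u0// mul1r; apply: Ap.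
    by rewrite leqnn (leq_trans ilt).
  by rewrite ltnW.
exists E; split => // x i ilt; rewrite (Ex x i ilt) big_nat [RHS]big_nat.
apply: eq_bigr => k /andP[_ kn]; congr (_ * _).
by rewrite /elim_coord [RHS]big_ltn// divff ?mul1r// u0.
Qed.

Definition permuted m n (H : 'M[C]_(m.+1, n.+1)) (s : 'S_m.+1) (t : 'S_n.+1) : nat -> nat -> C :=
  fun a b => H (s (inord a)) (t (inord b)).

(** Greedy construction: once K steps are settled, a largest entry of the remaining block is moved
    to position (K, K). The two transpositions fix all indices below K and preserve every block that
    starts at or before K, so the earlier inequalities survive. *)
Lemma complete_pivoting m n (H : 'M[C]_(m.+1, n.+1)) : (n <= m)%N ->
  exists s t, pivoted (permuted H s t) m.+1 n.+1.
Proof.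
move=> nm.
suff : forall K, (K <= n.+1)%N -> exists s t, forall k a b : nat, (k < K)%N ->
    (k <= a < m.+1)%N -> (k <= b < n.+1)%N ->
    normc (schur (permuted H s t) k a b) <= normc (schur (permuted H s t) k k k).
  move=> /(_ n.+1 (leqnn _))[s [t h]]; exists s, t => k a b ha hb; apply: h => //.
  by case/andP: hb => kb /(leq_ltn_trans kb).
elim=> [_|K IHK Kn]; first by exists 1%g, 1%g.
have [s [t h]] := IHK (ltnW Kn); set A := permuted H s t in h.
have K_n : (K <= n)%N by [].
have K_m : (K <= m)%N by apply: leq_trans nm.
pose dom (p : 'I_m.+1 * 'I_n.+1) := (K <= p.1)%N && (K <= p.2)%N.
have dom0 : dom (inord K, inord K) by rewrite /dom /= !inordK// !leqnn.
have [[i j] /andP[/= Ki Kj] ijmax] := @arg_maxP _ _ _ (inord K, inord K) dom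
  (fun p => normc (schur A K p.1 p.2)) dom0.
pose p a : nat := tperm (inord K) i (inord a).
pose q b : nat := tperm (inord K) j (inord b).
have pfix a : (a < K)%N -> p a = a.
  move=> aK; have am : (a < m.+1)%N by lia.
  rewrite /p tpermD ?inordK// -val_eqE /= !inordK//; first by rewrite gtn_eqF.
  by rewrite gtn_eqF// (leq_trans aK).
have qfix b : (b < K)%N -> q b = b.
  move=> bK; have bn : (b < n.+1)%N by lia.
  rewrite /q tpermD ?inordK// -val_eqE /= !inordK//; first by rewrite gtn_eqF.
  by rewrite gtn_eqF// (leq_trans bK).
have pK : p K = i by rewrite /p tpermL.
have qK : q K = j by rewrite /q tpermL.
have p_ge k a : (k <= K)%N -> (k <= a < m.+1)%N -> (k <= p a < m.+1)%N.
  move=> kK /andP[ka am]; rewrite /p ltn_ord andbT.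
  by case: tpermP => _; rewrite ?inordK//; lia.
have q_ge k b : (k <= K)%N -> (k <= b < n.+1)%N -> (k <= q b < n.+1)%N.
  move=> kK /andP[kb bn]; rewrite /q ltn_ord andbT.
  by case: tpermP => _; rewrite ?inordK//; lia.
exists (tperm (inord K) i * s)%g, (tperm (inord K) j * t)%g => k a b kK ha hb.
have -> : permuted H (tperm (inord K) i * s)%g (tperm (inord K) j * t)%g =
    fun a b => A (p a) (q b).
  by apply/funext => a'; apply/funext => b'; rewrite /A /permuted /p /q !permM !inord_val.
have kK' : (k <= K)%N by [].
rewrite !schur_relabel; try by move=> l lk; rewrite ?pfix ?qfix// (leq_trans lk).
move: kK; rewrite ltnS leq_eqVlt => /predU1P[kEK|kK].
  rewrite kEK pK qK; have /andP[Kp pm] := p_ge k a kK' ha; have /andP[Kq qn] := q_ge k b kK' hb.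
  have := ijmax (Ordinal pm, Ordinal qn); apply.
  by rewrite /dom /= -kEK Kp.
by rewrite (pfix k)// (qfix k)//; apply: h => //; [exact: p_ge|exact: q_ge].
Qed.

End CompletePivoting.

(** * From the layers of the sphere decoder to a lattice count *)

Section SphereDecoder.
Variable R : realType.
Local Notation C := (R[i]).

Lemma sum_mxvec_index (V : nmodType) p q (f : 'I_(p * q) -> V) :
  \sum_l f l = \sum_(t < p) \sum_(b < q) f (mxvec_index t b).
Proof.
rewrite (reindex _ (curry_mxvec_bij p q)) pair_bigA /=.
by apply: eq_bigr => -[].
Qed.

Lemma kronI_mulE T p q (H : 'M[C]_(p, q)) (x : 'cV[C]_(T * q)) t a :
  (kronI T H *m x) (mxvec_index t a) 0 = \sum_b H a b * x (mxvec_index t b) 0.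
Proof.
rewrite mxE sum_mxvec_index (bigD1 t)//= [X in _ + X]big1 ?addr0.
  apply: eq_bigr => b _; rewrite mxE /mxvec_index !cast_ordK !enum_rankK /=.
  by rewrite eqxx.
move=> u ut; apply: big1 => b _; rewrite mxE /mxvec_index !cast_ordK !enum_rankK /=.
by rewrite eq_sym (negbTE ut) mul0r.
Qed.

Lemma conj_mul_cabs2 (z : C) : z^* * z = (cabs2 z)%:C%C.
Proof.
case: z => a b; rewrite /cabs2 /=; apply/eqP; rewrite eq_complex /= /cabs2 /=.
by apply/andP; split; apply/eqP; ring.
Qed.

Lemma ctr_mul_frob2 m (e : 'cV[C]_m) : (ctr e *m e) 0 0 = (frob2 e)%:C%C.
Proof.
rewrite mxE /frob2 rmorph_sum; apply: eq_bigr => i _.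
by rewrite !mxE big_ord1 conj_mul_cabs2.
Qed.

Lemma ctrM m n p (A : 'M[C]_(m, n)) (B : 'M[C]_(n, p)) : ctr (A *m B) = ctr B *m ctr A.
Proof. by rewrite /ctr map_mxM trmx_mul. Qed.

Lemma frob2_isometry m n (Q : 'M[C]_(m, n)) (e : 'cV[C]_n) :
  ctr Q *m Q = 1%:M -> frob2 (Q *m e) = frob2 e.
Proof.
move=> QQ; apply: (@complexI R); rewrite -!ctr_mul_frob2 ctrM.
by rewrite -mulmxA (mulmxA (ctr Q)) QQ mul1mx.
Qed.

Lemma normc_le_frob2 m (e : 'cV[C]_m) i : normc (e i 0) <= Num.sqrt (frob2 e).
Proof.
rewrite -[leLHS]ger0_norm ?normc_ge0// -sqrtr_sqr ler_wsqrtr// normc_cabs2 /frob2.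
rewrite (bigD1 i)//= big_ord1 lerDl; apply: sumr_ge0 => j _; apply: sumr_ge0 => l _.
by rewrite /cabs2 addr_ge0 ?sqr_ge0.
Qed.

Lemma unitmx_inj n (A : 'M[C]_n) : (forall v : 'cV_n, A *m v = 0 -> v = 0) -> A \in unitmx.
Proof.
move=> inj; rewrite -unitmx_tr -row_free_unit -kermx_eq0; apply/rowV0P => v.
move=> /sub_kermxP vA; apply: trmx_inj; rewrite trmx0; apply: inj.
by rewrite -[A]trmxK -trmx_mul vA trmx0.
Qed.

(** The bottom rows involve only the last unknowns, and the diagonal of an invertible triangular
    matrix has no zero. *)
Lemma upper_trig_tail n (A : 'M[C]_n) (p : 'cV[C]_n) (j0 : nat) :
  A \in unitmx -> (forall i j : 'I_n, (j < i)%N -> A i j = 0) ->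
  (forall i : 'I_n, (j0 <= i)%N -> (A *m p) i 0 = 0) ->
  forall i : 'I_n, (j0 <= i)%N -> p i 0 = 0.
Proof.
move=> uA trA Ap.
have Aii i : A i i != 0.
  have : \det A != 0 by rewrite -unitfE -unitmxE.
  rewrite -det_tr det_trig; last first.
    by apply/is_trig_mxP => a b ab; rewrite mxE trA.
  by move=> /prodf_neq0/(_ i isT); rewrite mxE.
suff : forall d (i : 'I_n), (n - i <= d)%N -> (j0 <= i)%N -> p i 0 = 0.
  by move=> h i; apply: (h n); rewrite leq_subr.
elim=> [|d IHd] i id ji; first by have := ltn_ord i; lia.
have := Ap i ji; rewrite mxE (bigD1 i)//= big1 ?addr0.
  by move=> /eqP; rewrite mulf_eq0 (negbTE (Aii i)) => /eqP.
move=> j ij; have [jlt|jge] := ltnP j i; first by rewrite trA// mul0r.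
have ltij : (i < j)%N by rewrite ltn_neqAle jge andbT eq_sym.
by rewrite IHd ?mulr0//; have := ltn_ord j; lia.
Qed.

(** Layer k sees only the block R_k, while the elimination concerns H. To connect them, the partial
    residual is padded with zeros to a vector e, and w solves R w = e. Then M w = Q e has squared
    norm equal to the partial metric, which confines the elimination coordinates of G w; and, R
    being triangular, differences of w agree up to sign with differences of symbols on the last k
    entries. The centre r cancels in these differences. [C1] depends only on the code and the
    dimensions. *)
Lemma sd_layer_count m n T (D : 'I_(kappa n.+1 T) -> 'M[C]_(n.+1, T)) :
  (n <= m)%N -> ldc_gen D \in unitmx ->
  exists2 C1 : R, 0 <= C1 & forall (H : 'M[C]_(m.+1, n.+1)) (s : 'S_m.+1) (t : 'S_n.+1)
      (theta xi2 : R) (QR : 'M[C]_(T * m.+1, kappa n.+1 T) * 'M[C]_(kappa n.+1 T))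
      (r : 'cV[C]_(kappa n.+1 T)) (eta k : nat) (F : {set 'I_n.+1}),
    pivoted (permuted H s t) m.+1 n.+1 ->
    (forall l, (l < n.+1)%N -> schur (permuted H s t) l l l != 0) ->
    theta != 0 -> (k <= kappa n.+1 T)%N ->
    thinQR ((Complex theta 0 : C) *: (kronI T H *m ldc_gen D)) QR ->
    #|[set sk : k.-tuple (QI eta) | partial_metric r QR.2 sk <= xi2]|%:R <=
    (\prod_(i in ~: F) (1 + C1 * (Num.sqrt xi2 / `|theta| / pivot (permuted H s t) i))) ^+ (2 * T)
      * (2 * eta%:R + 1) ^+ (2 * (T * #|F|)).
Proof.
move=> nm uG; set kap := kappa n.+1 T in D uG *.
pose Gi := invmx (ldc_gen D).
pose SG := \sum_i \sum_j normc (Gi i j).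
have SG_ge i j : normc (Gi i j) <= SG.
  rewrite /SG (bigD1 i)//= (bigD1 j)//= -addrA lerDl addr_ge0//; last first.
    by apply: sumr_ge0 => a _; apply: sumr_ge0 => b _; exact: normc_ge0.
  by apply: sumr_ge0 => b _; exact: normc_ge0.
have SG0 : 0 <= SG by apply: sumr_ge0 => a _; apply: sumr_ge0 => b _; exact: normc_ge0.
pose B : R := n.+2%:R ^+ n.+1.
pose C0 := \sum_(b < n.+1) SG * B.
have C00 : 0 <= C0 by apply: sumr_ge0 => b _; rewrite mulr_ge0// exprn_ge0.
exists (2 / cell_width C0 #|{: 'I_T * 'I_n.+1}|).
  by rewrite divr_ge0// ltW// cell_width_gt0.
move=> H s t theta xi2 [Q Rm] r eta k F Ap u0 th0 kkap [/= QQ MQR trR].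
rewrite -cardsE; set V := finset.finset _.
have Vxi v : v \in V -> partial_metric r Rm v <= xi2 by rewrite inE => /set_mem.
set A := permuted H s t in Ap u0 *.
set M := _ *: _ in MQR.
have [E [E1 Ex]] := elim_coord_inverse Ap nm u0.
have kronM (w : 'cV[C]_kap) (u : 'I_T) (a : 'I_m.+1) : (M *m w) (mxvec_index u a) 0 =
    Complex theta 0 * \sum_b H a b * (ldc_gen D *m w) (mxvec_index u b) 0.
  by rewrite -scalemxAl mxE -mulmxA kronI_mulE.
(* Channel use u of G w, in pivoted column order; M acts on each channel use separately, as theta
   H. *)
pose xx (w : 'cV[C]_kap) (u : 'I_T) (b : nat) : C :=
  (ldc_gen D *m w) (mxvec_index u (t (inord b))) 0.
have rowE (w : 'cV[C]_kap) (u : 'I_T) a : (a < m.+1)%N ->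
    \sum_(0 <= b < n.+1) A a b * xx w u b =
    (Complex theta 0)^-1 * (M *m w) (mxvec_index u (s (inord a))) 0.
  move=> am; rewrite kronM mulKf ?big_mkord; last first.
    by rewrite eq_complex /= eqxx andbT.
  rewrite [RHS](reindex_inj (@perm_inj _ t)); apply: eq_bigr => b _.
  by rewrite /A /permuted /xx inord_val.
have normth : normc (Complex theta 0 : C)^-1 = `|theta|^-1.
  by rewrite ComplexField.Normc.normcV /= expr0n addr0 sqrtr_sqr.
(* M is injective: with nonzero pivots a zero residual forces zero elimination coordinates, and G is
   invertible. *)
have uR : Rm \in unitmx.
  apply: unitmx_inj => v Rv.
  have Mv : M *m v = 0 by rewrite MQR -mulmxA Rv mulmx0.
  have xx0 u b : (b < n.+1)%N -> xx v u b = 0.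
    move=> bn; rewrite (Ex _ _ bn) big_nat big1// => c /andP[_ cn].
    have : normc (elim_coord A n.+1 (xx v u) c) <= 0 / pivot A c.
      apply: (elim_coord_le Ap) => // a am.
      by rewrite rowE// Mv mxE mulr0 ComplexField.Normc.normc0.
    rewrite mul0r => h; rewrite (@ComplexField.Normc.eq0_normc _ (elim_coord _ _ _ _)) ?mulr0//.
    by apply/eqP; rewrite eq_le h normc_ge0.
  have Gv : ldc_gen D *m v = 0.
    apply/colP => l; case/mxvec_indexP: l => u b; rewrite [RHS]mxE.
    have := xx0 u (t^-1 b)%g (ltn_ord _); by rewrite /xx inord_val permKV.
  by rewrite -(mulKmx uG v) Gv mulmx0.
pose sy (v : k.-tuple (QI eta)) (i : 'I_kap) : QI eta :=
  if (kap - k <= i)%N then nth (qdef eta) v (i - (kap - k)) else qdef eta.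
pose e (v : k.-tuple (QI eta)) : 'cV[C]_kap := \col_i
  if (kap - k <= i)%N then r i 0 - \sum_(j < kap | (kap - k <= j)%N)
                       Rm i j * qval R (nth (qdef eta) v (j - (kap - k))) else 0.
have frob_e v : frob2 (e v) = partial_metric r Rm v.
  rewrite /frob2 /partial_metric [RHS]big_mkcond; apply: eq_bigr => i _.
  by rewrite big_ord1 mxE; case: ifP => // _; rewrite /cabs2 /= expr0n addr0.
pose w v := invmx Rm *m e v.
have Rw v : Rm *m w v = e v by rewrite mulKVmx.
have w_tail v v' (i : 'I_kap) : (kap - k <= i)%N ->
    qval R (sy v i) - qval R (sy v' i) = - (w v i 0 - w v' i 0).
  move=> ki.
  (* On the last k entries, R (w v - w v') equals -R_k applied to the symbol difference, and R [dl]
     adds the same vector back, so the tail of w v - w v' + dl vanishes. *)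
  pose dl : 'cV[C]_kap := \col_j if (kap - k <= j)%N then qval R (sy v j) - qval R (sy v' j) else 0.
  have addE (a b c : 'cV[C]_kap) : (a - b + c) i 0 = a i 0 - b i 0 + c i 0 by rewrite !mxE.
  suff : (w v - w v' + dl) i 0 = 0.
    rewrite addE [dl i 0]mxE ki addrC => /eqP; rewrite addr_eq0 => /eqP ->.
    by rewrite opprB.
  apply: (upper_trig_tail uR trR _ ki).
  move=> j kj; rewrite mulmxDr mulmxBr !Rw !mxE kj.
  have cancel (a b c : C) : a - b - (a - c) = - (b - c) by ring.
  rewrite cancel -sumrB addrC; apply/eqP; rewrite subr_eq0 [X in _ == X]big_mkcond; apply/eqP.
  apply: eq_bigr => l _; rewrite !mxE; case: ifPn => kl; last by rewrite mulr0.
  by rewrite /sy kl; ring.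
pose y (v : k.-tuple (QI eta)) (uc : 'I_T * 'I_n.+1) : C :=
  elim_coord A n.+1 (xx (w v) uc.1) uc.2.
pose AA (i : 'I_kap) (uc : 'I_T * 'I_n.+1) : C :=
  if (kap - k <= i)%N then - \sum_(b < n.+1) Gi i (mxvec_index uc.1 (t b)) * E b uc.2 else 0.
(* The same columns [F] are left to symbols in each of the T channel uses, whence T |F| symbols. *)
pose FK : {set 'I_T * 'I_n.+1} := finset.setX finset.setT F.
have mv0 u : (Num.sqrt xi2 / `|theta| / pivot A u) >= 0.
  by apply: divr_ge0 (pivot_ge0 _ _); apply: divr_ge0 (normr_ge0 _); exact: sqrtr_ge0.
have AAC i uc : normc (AA i uc) <= C0.
  rewrite /AA; case: ifP => _; last by rewrite ComplexField.Normc.normc0.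
  rewrite normcN; apply: le_trans (normc_sum _ _ _) _; apply: ler_sum => b _.
  by rewrite ComplexField.Normc.normcM; apply: ler_pM; rewrite ?normc_ge0// E1.
have ybnd v uc : v \in V -> uc \notin FK ->
    normc (y v uc) <= Num.sqrt xi2 / `|theta| / pivot A uc.2.
  move=> vV _; apply: (elim_coord_le Ap) => // a am.
  rewrite rowE// ComplexField.Normc.normcM normth mulrC ler_wpM2r ?invr_ge0//.
  rewrite MQR -mulmxA Rw; apply: le_trans (normc_le_frob2 _ _) _.
  by rewrite frob2_isometry// frob_e ler_wsqrtr// Vxi.
have syE v v' i : v \in V -> v' \in V ->
    qval R (sy v i) - qval R (sy v' i) = \sum_uc AA i uc * (y v uc - y v' uc).
  move=> _ _; have [ki|ki] := boolP (kap - k <= i)%N; last first.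
    rewrite big1 => [|uc _]; last by rewrite /AA (negbTE ki) mul0r.
    by rewrite /sy (negbTE ki) subrr.
  have wE v0 : w v0 i 0 = \sum_l Gi i l * (ldc_gen D *m w v0) l 0.
    by rewrite -{1}(mulKmx uG (w v0)) mxE.
  rewrite w_tail// !wE -sumrB sum_mxvec_index -sumrN.
  transitivity (\sum_(u < T) \sum_(c < n.+1)
      - (\sum_(b < n.+1) Gi i (mxvec_index u (t b)) * E b c) * (y v (u, c) - y v' (u, c))).
    2: by rewrite pair_bigA; apply: eq_bigr => -[u c] _; rewrite /AA ki.
  apply: eq_bigr => u _.
  rewrite (reindex_inj (@perm_inj _ t)).
  under [RHS]eq_bigr do rewrite mulNr mulr_suml.
  rewrite [RHS]sumrN; congr (- _); rewrite [RHS]exchange_big /=; apply: eq_bigr => b _.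
  have xE w' : (ldc_gen D *m w') (mxvec_index u (t b)) 0 =
      \sum_(c < n.+1) E b c * elim_coord A n.+1 (xx w' u) c.
    by have := Ex (xx w' u) b (ltn_ord b); rewrite big_mkord /xx inord_val.
  rewrite !xE -mulrBr -sumrB mulr_sumr; apply: eq_bigr => c _.
  by rewrite /y /=; ring.
have syI v v' : v \in V -> v' \in V -> (forall i, sy v i = sy v' i) -> v = v'.
  move=> _ _ h; apply: eq_from_tnth => i.
  have ik : (kap - k + i < kap)%N by have := ltn_ord i; lia.
  have := h (Ordinal ik); rewrite /sy /= leq_addr addKn.
  by rewrite !(tnth_nth (qdef eta)).
have := @lattice_count R _ _ _ V eta sy y AA FK
  (fun uc => Num.sqrt xi2 / `|theta| / pivot A uc.2) C0 C00 AAC (fun uc => mv0 uc.2)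
  ybnd syE syI.
rewrite cardsX cardsT card_ord => /le_trans; apply.
rewrite ler_wpM2r ?exprn_ge0 ?addr_ge0 ?mulr_ge0//.
set c1 := 2 / _.
have -> : \prod_(uc in ~: FK) (1 + c1 * (Num.sqrt xi2 / `|theta| / pivot A uc.2)) =
    (\prod_(i in ~: F) (1 + c1 * (Num.sqrt xi2 / `|theta| / pivot A i))) ^+ T.
  rewrite -[in RHS](card_ord T) -prodr_const.
  rewrite (pair_big predT (fun i => i \in ~: F)) /=.
  by apply: eq_bigl => -[u c]; rewrite !inE.
by rewrite -exprM mulnC.
Qed.

End SphereDecoder.

(** * Small-ball events for independent coordinates with bounded density *)

Section SmallBall.
Variables (R : realType) (d : measure_display) (Omega : measurableType d)
  (P : probability Omega R) (I : finType) (X : I -> Omega -> R).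
Hypothesis mX : forall i, measurable_fun setT (X i).
Hypothesis indepX : forall B : I -> set R, (forall i, measurable (B i)) ->
  P [set w | forall i, B i (X i w)] = (\prod_i P (X i @^-1` B i))%E.

Definition cylinders (J : pred I) : set (set Omega) :=
  [set A | exists B : I -> set R, [/\ forall i, measurable (B i),
     forall i, ~~ J i -> B i = setT & A = [set w | forall i, B i (X i w)]]].

(** Measurability for the sigma-algebra generated by the coordinates in [J]. Changing the measurable
    type of the domain lets closure properties of measurable functions apply directly. *)
Definition depends_on (J : pred I) (f : Omega -> R) : Prop :=
  @measurable_fun _ _ (g_sigma_algebraType (cylinders J)) R setT f.

Lemma measurable_cylinders J : cylinders J `<=` measurable.
Proof.
move=> A [B [mB _ ->]].
rewrite (_ : [set _ | _] = \bigcap_(i in [set: I]) (X i @^-1` B i)); last first.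
  by apply/seteqP; split => w h i //=; exact: h.
apply: fin_bigcap_measurable; first exact: finite_finset.
by move=> i _; rewrite -[X in measurable X]setTI; exact: mX.
Qed.

Lemma cylinders_setI J : setI_closed (cylinders J).
Proof.
move=> A1 A2 [B1 [mB1 J1 ->]] [B2 [mB2 J2 ->]]; exists (fun i => B1 i `&` B2 i); split.
- by move=> i; exact: measurableI.
- by move=> i Ji; rewrite J1// J2// setTI.
- by apply/seteqP; split => [w [h1 h2] i|w h]; [split|split => i; have [] := h i].
Qed.

Lemma cylinders_setT J : cylinders J setT.
Proof. by exists (fun=> setT); split => //; apply/seteqP; split. Qed.

Lemma cylinders_mono (J J' : pred I) : (forall i, J i -> J' i) ->
  cylinders J `<=` cylinders J'.
Proof.
move=> JJ' A [B [mB BJ ->]]; exists B; split => // i J'i; apply: BJ.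
by apply: contra J'i; exact: JJ'.
Qed.

Lemma sigma_cylinders_measurable J A : <<s cylinders J >> A -> measurable A.
Proof. by apply: smallest_sub; [exact: sigma_algebra_measurable|exact: measurable_cylinders]. Qed.

Lemma depends_on_mono (J J' : pred I) f : (forall i, J i -> J' i) ->
  depends_on J f -> depends_on J' f.
Proof.
move=> JJ' mf _ B mB; apply: sub_sigma_algebra2 (cylinders_mono JJ') _ _.
exact: (mf measurableT B mB).
Qed.

Lemma depends_on_coord (J : pred I) i : J i -> depends_on J (X i).
Proof.
move=> Ji mD B mB; rewrite setTI; apply: sub_sigma_algebra.
exists (fun j => if j == i then B else setT); split.
- by move=> j; case: ifP.
- by move=> j; case: ifPn => // /eqP ->; rewrite Ji.
- apply/seteqP; split => [w Bw j|w /(_ i)]; last by rewrite eqxx.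
  by case: ifPn => // /eqP ->.
Qed.

(** Both sides are finite measures in A and agree on the cylinders, a pi-system generating the
    sigma-algebra. *)
Lemma indep_sigma (J : pred I) e (B : set R) (A : set Omega) : ~~ J e -> measurable B ->
  <<s cylinders J >> A -> P (A `&` X e @^-1` B) = (P (X e @^-1` B) * P A)%E.
Proof.
move=> Je mB sA.
have mXB : measurable (X e @^-1` B) by rewrite -[X in measurable X]setTI; exact: mX.
have p0 : 0 <= fine (P (X e @^-1` B)) by exact: fine_ge0.
pose m1 := mrestr P mXB; pose m2 := mscale (NngNum p0) P.
have m2E A' : m2 A' = (P (X e @^-1` B) * P A')%E.
  by rewrite /m2 /mscale /= fineK// fin_num_measure.
rewrite -m2E; apply: (@g_sigma_algebra_measure_unique _ _ _ (cylinders J) _ (fun=> setT) _ _ m1 m2) => //.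
- exact: measurable_cylinders.
- by move=> _; exact: cylinders_setT.
- by rewrite bigcup_const.
- exact: cylinders_setI.
- move=> _ [C [mC CJ ->]].
  rewrite [RHS]m2E /m1 /mrestr [X in P X = _](_ : _ = [set w | forall i, (if i == e then B else C i) (X i w)]); last first.
    apply/seteqP; split => [w [Cw Bw] i|w h].
      by case: ifPn => // /eqP ->.
    split; last by have := h e; rewrite eqxx.
    move=> i; have := h i; case: ifPn => // /eqP -> _; by rewrite CJ.
  rewrite (@indepX (fun i => if i == e then B else C i)); last by move=> i; case: (i == e).
  rewrite indepX// (bigD1 e)//= eqxx [in RHS](bigD1 e)//= (CJ e Je) preimage_setT.
  rewrite probability_setT mul1e; congr (_ * _)%E; apply: eq_bigr => i ie.
  by rewrite (negbTE ie).
- by move=> _; rewrite /m1 /mrestr; apply: le_lt_trans (probability_le1 _ _) (ltry _); exact: measurableI.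
Qed.

Variable K : R.
Hypothesis K_density : forall e (a b : R), a <= b ->
  (P (X e @^-1` `[a, b]) <= (K * (b - a))%:E)%E.

(* The centre c is discretised into cells of width eps; on each cell the event
   constrains X e to an interval of length 3 eps. *)
Lemma small_ball_step (J : pred I) e (c : Omega -> R) (A : set Omega) (eps : R) :
  ~~ J e -> depends_on J c -> <<s cylinders J >> A -> 0 < eps ->
  (P ([set w | (`|X e w - c w| <= eps)%R] `&` A) <= (3 * K * eps)%:E * P A)%E.
Proof.
move=> Je mc sA eps0.
(* [pickle] numbers the integer cells by naturals, so that countable additivity applies; a number
   that codes no integer gives an empty cell. *)
pose U n := [set w | pickle (Num.floor (c w / eps)) = n].
have sU n : <<s cylinders J >> (U n).
  have [[z zn]|nz] := pselect (exists z : int, pickle z = n).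
    rewrite (_ : U n = setT `&` c @^-1` `[z%:~R * eps, (z + 1)%:~R * eps[%classic).
      by apply: (mc measurableT); exact: measurable_itv.
    rewrite setTI; apply/seteqP; split => w; rewrite /U /= in_itv /=.
      rewrite -zn => /(pcan_inj (@pickleK _)) zE.
      by rewrite -ler_pdivlMr// -ltr_pdivrMr// -zE floor_itv ?num_real.
    rewrite -ler_pdivlMr// -ltr_pdivrMr// => h; rewrite -zn; congr pickle.
    exact: floor_def.
  rewrite (_ : U n = set0); first exact: sigma_algebra0.
  by apply/seteqP; split => w //= wn; apply: nz; exists (Num.floor (c w / eps)).
have mA := sigma_cylinders_measurable sA.
have mU n := sigma_cylinders_measurable (sU n).
pose E := [set w | (`|X e w - c w| <= eps)%R].
have mE : measurable E.
  have mc' : measurable_fun setT c.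
    move=> _ B mB; apply: (@sigma_cylinders_measurable J); exact: (mc measurableT).
  have mf : measurable_fun setT (fun w => `|X e w - c w|).
    by apply: measurableT_comp => //; apply: measurable_funB.
  rewrite (_ : E = setT `&` (fun w => `|X e w - c w|) @^-1` `]-oo, eps]%classic).
    by apply: (mf measurableT); exact: measurable_itv.
  by rewrite setTI; apply/seteqP; split => w; rewrite /= in_itv.
have AE : A = \bigcup_n (A `&` U n).
  by apply/seteqP; split => [w Aw|w [n _ []]//]; exists (pickle (Num.floor (c w / eps))).
have K0 : 0 <= K.
  have := @K_density e 0 1 ler01; rewrite subr0 mulr1; apply: contraTT.
  by rewrite -!ltNge => K0; apply: lt_le_trans (measure_ge0 _ _); rewrite lte_fin.
have step n : (P (E `&` (A `&` U n)) <= (3 * K * eps)%:E * P (A `&` U n))%E.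
  have [[z zn]|nz] := pselect (exists z : int, pickle z = n); last first.
    rewrite (_ : U n = set0) ?setI0 ?measure0 ?mule0//.
    by apply/seteqP; split => w //= wn; apply: nz; exists (Num.floor (c w / eps)).
  pose B := `[z%:~R * eps - eps, z%:~R * eps + 2 * eps]%classic : set R.
  apply: (@le_trans _ _ (P ((A `&` U n) `&` X e @^-1` B))).
    apply: le_measure; rewrite ?inE.
    - by apply: measurableI => //; exact: measurableI.
    - apply: measurableI; first exact: measurableI.
      by rewrite -[X in measurable X]setTI; apply: mX => //; exact: measurable_itv.
    move=> w [Ew [Aw Uw]]; split => //; rewrite /B /= in_itv /=.
    move: Uw; rewrite /U /= -zn => /(pcan_inj (@pickleK _)) zE.
    have := floor_itv (c w / eps); rewrite zE ler_pdivlMr// ltr_pdivrMr//.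
    rewrite intrD mulrDl mul1r => /andP[c1 c2].
    move: Ew; rewrite /E /= ler_norml => /andP[e1 e2].
    by apply/andP; split; lra.
  have mB : measurable B by exact: measurable_itv.
  have sAU : <<s cylinders J >> (A `&` U n).
    exact: (@measurableI _ (g_sigma_algebraType (cylinders J)) A (U n) sA (sU n)).
  rewrite (indep_sigma Je mB sAU).
  apply: lee_wpmul2r => //; apply: le_trans (K_density _ _) _; first by lra.
  by rewrite lee_fin; nra.
have mEA n : measurable (E `&` (A `&` U n)) by apply: measurableI => //; exact: measurableI.
have EAE : E `&` A = \bigcup_n (E `&` (A `&` U n)) by rewrite {1}AE setI_bigcupr.
have tU : trivIset setT (fun n => A `&` U n).
  by move=> i j _ _ [w [[_ <-] [_ <-]]].
apply: (@le_trans _ _ (\sum_(0 <= n <oo) P (E `&` (A `&` U n)))%E).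
  rewrite -/E EAE; apply: measure_sigma_subadditive => //.
  by apply: bigcup_measurable.
apply: (@le_trans _ _ (\sum_(0 <= n <oo) ((3 * K * eps)%:E * P (A `&` U n)))%E).
  by apply: lee_nneseries => // n _ _; exact: step.
rewrite nneseriesZl// -measure_semi_bigcup -?AE// => n.
exact: measurableI.
Qed.

Variable lev : I -> nat.
Variable c : I -> Omega -> R.
Hypothesis mc : forall e, depends_on (fun j => (lev j < lev e)%N) (c e).
Variable eps : I -> R.
Hypothesis eps_gt0 : forall e, 0 < eps e.

Lemma small_ball_event_sigma (J : pred I) e : J e -> (forall j, (lev j < lev e)%N -> J j) ->
  <<s cylinders J >> [set w | `|X e w - c e w| <= eps e].
Proof.
move=> Je Jlt.
have mf : depends_on J (fun w => `|X e w - c e w|).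
  apply: measurableT_comp => //; apply: measurable_funB; first exact: depends_on_coord.
  exact: depends_on_mono Jlt (@mc e).
rewrite [X in <<s _ >> X](_ : _ = setT `&` (fun w => `|X e w - c e w|) @^-1` `]-oo, eps e]%classic).
  by apply: (mf measurableT); exact: measurable_itv.
by rewrite setTI; apply/seteqP; split => w; rewrite /= in_itv.
Qed.

(** Coordinates are peeled off by decreasing level. The head e has maximal level, so neither its own
    centre nor the remaining events involve [X e]; [small_ball_step] applies with [J] everything but
    e. *)
Lemma small_ball_prob (s : seq I) : uniq s -> sorted (fun e e' => (lev e' <= lev e)%N) s ->
  (P [set w | forall e, e \in s -> (`|X e w - c e w| <= eps e)%R]
    <= (\prod_(e <- s) (3 * K * eps e))%:E)%E.
Proof.
elim: s => [|e s IHs] /=.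
  by rewrite big_nil => _ _; apply: probability_le1; rewrite (_ : [set _ | _] = setT)//;
    apply/seteqP; split.
move=> /andP[es us] pes.
have tr : transitive (fun e e' : I => (lev e' <= lev e)%N) by move=> a b c' h1 h2; exact: leq_trans h1.
have lev_le j : j \in s -> (lev j <= lev e)%N by move: pes; rewrite (path_sortedE tr) => /andP[/allP h _] /h.
pose J := predC1 e.
set A := [set w | forall e, e \in s -> _] in IHs.
have sA : <<s cylinders J >> A.
  rewrite (_ : A = \bigcap_(j in [set` s]) [set w | `|X j w - c j w| <= eps j]); last first.
    by apply/seteqP; split.
  apply: (@fin_bigcap_measurable _ (g_sigma_algebraType (cylinders J))); first exact: finite_seq.
  move=> j js; apply: small_ball_event_sigma => [|l ll].
    by rewrite /J /=; apply: contra es => /eqP <-.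
  rewrite /J /=; apply: contraTneq ll => ->; rewrite -leqNgt; exact: lev_le.
rewrite (_ : [set w | _] = [set w | `|X e w - c e w| <= eps e] `&` A); last first.
  apply/seteqP; split => [w h|w [h1 h2] j].
    by split => [|j js]; apply: h; rewrite inE ?eqxx// js orbT.
  by rewrite inE => /orP[/eqP->//|]; exact: h2.
have K0 : 0 <= K.
  have := @K_density e 0 1 ler01; rewrite subr0 mulr1; apply: contraTT.
  by rewrite -!ltNge => K0; apply: lt_le_trans (measure_ge0 _ _); rewrite lte_fin.
apply: le_trans (small_ball_step _ (J := J) _ sA (eps_gt0 e)) _.
- by rewrite /J /= eqxx.
- by apply: depends_on_mono (@mc e) => j; rewrite /J /=; apply: contraTneq => ->; rewrite ltnn.
rewrite big_cons [X in (_ <= X)%E]EFinM; apply: lee_wpmul2l; first by rewrite lee_fin !mulr_ge0// ltW.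
by apply: IHs => //; exact: path_sorted pes.
Qed.

End SmallBall.

(** * Probability that the pivots of a Gaussian matrix are small *)

Section GaussianPivots.
Variable R : realType.
Local Notation C := (R[i]).

Lemma normal_prob_itv_le (mu s a b : R) : s != 0 -> a <= b ->
  (normal_prob mu s `[a, b] <= (normal_peak s * (b - a))%:E)%E.
Proof.
move=> s0 ab; rewrite /normal_prob.
apply: (@le_trans _ _ (\int[lebesgue_measure]_(x in `[a, b]) (normal_peak s)%:E)%E).
  apply: ge0_le_integral => //=.
  - by move=> x _; rewrite lee_fin normal_pdf_ge0.
  - apply/measurable_funTS/measurableT_comp => //=; exact: measurable_normal_pdf.
  - by move=> x _; rewrite lee_fin normal_pdf_ub.
rewrite integral_cst//= lebesgue_measure_itv /= lte_fin.
have [lab|] := ltP a b; first by rewrite -EFinD -EFinM.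
by move=> ba; rewrite mule0 lee_fin mulr_ge0 ?normal_peak_ge0 ?subr_ge0.
Qed.

(** The exponent is the number of pairs (a, b) with min(a, b) = k, namely (m - k) + (n - k) - 1. *)
Lemma prod_minn_ord (x : nat -> R) (m n : nat) : (n <= m)%N ->
  \prod_(a < m) \prod_(b < n) x (minn a b) = \prod_(k < n) x k ^+ (m + n - k.*2.+1).
Proof.
move=> nm.
have row b : (b < n)%N -> \prod_(a < m) x (minn a b) = (\prod_(a < b) x a) * x b ^+ (m - b).
  move=> bn; have bm : (b <= m)%N by apply: leq_trans (ltnW bn) nm.
  rewrite -(big_mkord xpredT (fun a => x (minn a b))) (@big_cat_nat _ _ _ b)//= big_mkord.
  congr (_ * _); first by apply: eq_bigr => a _; rewrite (minn_idPl _)// ltnW.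
  rewrite big_nat (eq_bigr (fun=> x b)); last by move=> a /andP[ba _]; rewrite (minn_idPr _).
  by rewrite -big_nat prodr_const_nat.
have tri : \prod_(b < n) \prod_(a < b) x a = \prod_(a < n) x a ^+ (n - a.+1).
  elim: {nm row} n => [|n IHn]; first by rewrite !big_ord0.
  rewrite big_ord_recr IHn big_ord_recr /= subnn expr0 mulr1 -big_split /=.
  apply: eq_bigr => a _; rewrite -exprSr; congr (_ ^+ _); have := ltn_ord a; lia.
rewrite exchange_big /= (eq_bigr _ (fun (b : 'I_n) _ => row b (ltn_ord b))) big_split /= tri -big_split /=.
apply: eq_bigr => k _; rewrite -exprD; congr (_ ^+ _); have := ltn_ord k; lia.
Qed.

Definition cpart (b : bool) (z : C) : R := if b then complex.Re z else complex.Im z.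

Lemma cpart_le_normc b z : `|cpart b z| <= normc z.
Proof. by case: b; [exact: Re_le_normc|exact: Im_le_normc]. Qed.

Section ComplexMeasurable.
Context (d : measure_display) (Omega : measurableType d).
Implicit Types f g : Omega -> C.

Definition cmeasurable f := forall b, measurable_fun setT (fun w => cpart b (f w)).

Lemma cmeasurable_cst z : cmeasurable (fun=> z).
Proof. by move=> b; exact: measurable_cst. Qed.

Lemma cmeasurableB f g : cmeasurable f -> cmeasurable g -> cmeasurable (fun w => f w - g w).
Proof.
move=> mf mg b; rewrite (_ : (fun w => _) = (fun w => cpart b (f w) - cpart b (g w))).
  exact: measurable_funB.
by apply/funext => w; case: b; case: (f w) (g w) => [? ?] [? ?].
Qed.

Lemma cmeasurableM f g : cmeasurable f -> cmeasurable g -> cmeasurable (fun w => f w * g w).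
Proof.
move=> mf mg [].
  rewrite (_ : (fun w => _) = (fun w => cpart true (f w) * cpart true (g w) -
      cpart false (f w) * cpart false (g w))).
    by apply: measurable_funB; apply: measurable_funM.
  by apply/funext => w; case: (f w) (g w) => [? ?] [? ?].
rewrite (_ : (fun w => _) = (fun w => cpart true (f w) * cpart false (g w) +
    cpart false (f w) * cpart true (g w))).
  by apply: measurable_funD; apply: measurable_funM.
by apply/funext => w; case: (f w) (g w) => [? ?] [? ?].
Qed.

Lemma cmeasurableV f : cmeasurable f -> cmeasurable (fun w => (f w)^-1).
Proof.
move=> mf.
pose n2 w := (cpart true (f w) ^+ 2 + cpart false (f w) ^+ 2) `^ (-1).
have mn2 : measurable_fun setT n2.
  apply: (measurableT_comp (f := fun x : R => x `^ (-1))); first exact: measurable_powR.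
  by apply: measurable_funD; exact: measurable_funX.
have n2E w : n2 w = (cpart true (f w) ^+ 2 + cpart false (f w) ^+ 2)^-1.
  by rewrite /n2 powR_inv1// addr_ge0 ?sqr_ge0.
move=> [].
  rewrite (_ : (fun w => _) = (fun w => cpart true (f w) * n2 w)); first exact: measurable_funM.
  by apply/funext => w; rewrite n2E; case: (f w).
rewrite (_ : (fun w => _) = (fun w => - (cpart false (f w) * n2 w))).
  by apply: measurable_funN; exact: measurable_funM.
by apply/funext => w; rewrite n2E; case: (f w).
Qed.

End ComplexMeasurable.

Section PivotProbability.
Context (d : measure_display) (Omega : measurableType d) (P : probability Omega R).
Variables (m n T : nat) (H : Omega -> 'M[C]_(m.+1, n.+1)) (W : Omega -> 'M[C]_(m.+1, T)).
Hypothesis HW : iid_CN01 P H W.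
Hypothesis nm : (n <= m)%N.

Let I : finType := (('I_m.+1 * 'I_n.+1 * bool) + ('I_m.+1 * 'I_T * bool))%type.
Let X (g : I) (w : Omega) : R := gcoord (H w) (W w) g.

Section FixedPermutations.
Variables (s : 'S_m.+1) (t : 'S_n.+1).
Let A w := permuted (H w) s t.

(** The elimination step whose pivot row or column contains the entry. Position a holds row [s a] of
    H, hence the inverse permutations. *)
Definition level (g : I) : nat := match g with
  | inl (i, j, _) => minn ((s^-1)%g i) ((t^-1)%g j)
  | inr _ => 0%N end.

Let cdep (J : pred I) (f : Omega -> C) :=
  @cmeasurable _ (g_sigma_algebraType (cylinders X J)) f.

Lemma entry_dep (J : pred I) a b : (forall c, J (inl (s (inord a), t (inord b), c))) ->
  cdep J (fun w => A w a b).
Proof.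
move=> Jab c; rewrite (_ : (fun w => _) = X (inl (s (inord a), t (inord b), c))).
  exact: depends_on_coord.
by apply/funext => w; case: c.
Qed.

Lemma level_entry a b c : (a < m.+1)%N -> (b < n.+1)%N ->
  level (inl (s (inord a), t (inord b), c)) = minn a b.
Proof. by move=> am bn; rewrite /level /= !permK !inordK. Qed.

Lemma cdep_mono (J J' : pred I) f : (forall j, J j -> J' j) -> cdep J f -> cdep J' f.
Proof. by move=> JJ' Jf b; exact: (depends_on_mono JJ' (Jf b)). Qed.

(** The difference accumulates the corrections of the steps l < k, and step l reads only row l and
    column l of its complement, whose entries of A have level l. *)
Lemma schur_dep k a b : (k <= a < m.+1)%N -> (k <= b < n.+1)%N ->
  cdep (fun j => (level j < k)%N) (fun w => A w a b - schur (A w) k a b).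
Proof.
elim: k a b => [|k IHk] a b /andP[ka am] /andP[kb bn] /=.
  rewrite (_ : (fun w : Omega => _) = fun=> 0); first exact: cmeasurable_cst.
  by apply/funext => w; rewrite subrr.
have mono f : cdep (fun j => (level j < k)%N) f -> cdep (fun j => (level j < k.+1)%N) f.
  by apply: cdep_mono => j jk; exact: ltnW.
have ent a' b' : (k <= a' < m.+1)%N -> (k <= b' < n.+1)%N -> minn a' b' = k ->
    cdep (fun j => (level j < k.+1)%N) (fun w => schur (A w) k a' b').
  move=> ha hb hk; have /andP[_ am'] := ha; have /andP[_ bn'] := hb.
  rewrite (_ : (fun w : Omega => _) = fun w => A w a' b' - (A w a' b' - schur (A w) k a' b')).
    apply: cmeasurableB; last by apply: mono; apply: IHk.
    by apply: entry_dep => c; rewrite level_entry// hk ltnSn.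
  by apply/funext => w; rewrite subKr.
rewrite (_ : (fun w : Omega => _) = fun w => (A w a b - schur (A w) k a b) -
   (0 - schur (A w) k a k * schur (A w) k k b * (schur (A w) k k k)^-1)); last first.
  by apply/funext => w; rewrite sub0r opprK opprB addrA addrAC.
have kkm : (k <= k < m.+1)%N by rewrite leqnn (ltn_trans ka).
have kkn : (k <= k < n.+1)%N by rewrite leqnn (ltn_trans kb).
have kam : (k <= a < m.+1)%N by rewrite ltnW.
have kbn : (k <= b < n.+1)%N by rewrite ltnW.
apply: cmeasurableB; first by apply: mono; apply: IHk.
apply: cmeasurableB; first exact: cmeasurable_cst.
apply: cmeasurableM; last by apply: cmeasurableV; apply: ent => //; exact: minnn.
by apply: cmeasurableM; apply: ent => //; [apply/minn_idPr|apply/minn_idPl]; exact: ltnW.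
Qed.

(** The value of the coordinate that would annihilate its part of the Schur complement at the
    entry's own level; it is determined by coordinates of lower level. *)
Definition centre (g : I) (w : Omega) : R := match g with
  | inl (i, j, c) => let a := ((s^-1)%g i : nat) in let b := ((t^-1)%g j : nat) in
      cpart c (A w a b - schur (A w) (minn a b) a b)
  | inr _ => 0 end.

Lemma centre_dep g : depends_on X (fun j => (level j < level g)%N) (centre g).
Proof.
case: g => [[[i j] c]|g]; last exact: measurable_cst.
by apply: schur_dep; rewrite ltn_ord andbT ?geq_minl ?geq_minr.
Qed.

Lemma coord_sub_centre i j c w :
  X (inl (i, j, c)) w - centre (inl (i, j, c)) w =
  cpart c (schur (A w) (level (inl (i, j, c))) ((s^-1)%g i) ((t^-1)%g j)).
Proof.
have -> : X (inl (i, j, c)) w = cpart c (A w ((s^-1)%g i) ((t^-1)%g j)).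
  by rewrite /A /permuted !inord_val !permKV; case: c.
rewrite /centre /level.
have cpartB z z' : cpart c (z - z') = cpart c z - cpart c z'.
  by case: c; case: z z' => [? ?] [? ?].
by rewrite cpartB subKr.
Qed.

End FixedPermutations.
Local Arguments level : simpl never.

(** Maximality bounds the whole block left at step k by 2^k [pivot], so both real coordinates of
    each of the m + n + 1 - 2k entries of level k lie near their centres. The value [eps k = 1]
    encodes the absence of a constraint at step k. [E] is a finite intersection of small-ball
    events, hence measurable. *)
Lemma pivots_small_ball : exists2 C0 : R, 0 <= C0 &
  forall (s : 'S_m.+1) (t : 'S_n.+1) (eps : nat -> R), (forall k, 0 < eps k <= 1) ->
  exists E : set Omega, [/\ measurable E,
    forall w, pivoted (permuted (H w) s t) m.+1 n.+1 ->
      (forall k, (k < n.+1)%N -> eps k < 1 -> pivot (permuted (H w) s t) k <= eps k) -> E w &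
    (P E <= (C0 * \prod_(k < n.+1) (eps k ^+ 2) ^+ (m.+1 + n.+1 - k.*2.+1))%:E)%E].
Proof.
case: HW => mX distX indX.
pose K := normal_peak (Num.sqrt (2^-1) : R).
have Kd (e : I) (a b : R) : a <= b -> (P (X e @^-1` `[a, b]) <= (K * (b - a))%:E)%E.
  move=> ab; rewrite (distX e) ; last exact: measurable_itv.
  by apply: normal_prob_itv_le; rewrite // sqrtr_eq0 -ltNge invr_gt0.
have K0 : 0 <= K by exact: normal_peak_ge0.
(* Dominates both 3 K 2^k, the factor of a constrained coordinate, and 1, that of an unconstrained
   one. *)
pose K1 := 1 + 3 * K * 2 ^+ n.
have K11 : 1 <= K1 by rewrite lerDl !mulr_ge0// exprn_ge0.
exists ((K1 ^+ 2) ^+ (m.+1 * n.+1)); first by rewrite !exprn_ge0// (le_trans ler01).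
move=> s t eps eps01.
have eps0 k : 0 < eps k by have /andP[] := eps01 k.
pose ep (g : I) := 2 ^+ level s t g * eps (level s t g).
have ep0 g : 0 < ep g by rewrite mulr_gt0// exprn_gt0.
pose act (g : I) := if g is inl _ then eps (level s t g) < 1 else false.
pose leT (e e' : I) := (level s t e' <= level s t e)%N.
pose l := sort leT (seq.filter act (enum I)).
have ul : uniq l by rewrite sort_uniq filter_uniq// enum_uniq.
have sl : sorted leT l by apply: sort_sorted => a b; exact: leq_total.
exists [set w | forall e, e \in l -> `|X e w - centre s t e w| <= ep e]; split.
- rewrite (_ : [set _ | _] =
      \bigcap_(j in [set` l]) [set w | `|X j w - centre s t j w| <= ep j]); last first.
    by apply/seteqP; split.
  apply: fin_bigcap_measurable; first exact: finite_seq.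
  move=> j _; apply: (@sigma_cylinders_measurable _ _ _ _ X mX xpredT).
  by apply: (@small_ball_event_sigma _ _ _ _ X (level s t)) => // e; exact: centre_dep.
- move=> w Ap pe e; rewrite mem_sort mem_filter => /andP[+ _].
  case: e => [[[i j] c]|//] ae; rewrite coord_sub_centre.
  set k := level _ _ _.
  have kn : (k < n.+1)%N by rewrite /k /level; apply: leq_ltn_trans (geq_minr _ _) (ltn_ord _).
  apply: le_trans (cpart_le_normc _ _) _.
  apply: le_trans (normc_schur_le_pivot Ap _ _) _.
  + by rewrite ltn_ord andbT geq_minl.
  + by rewrite ltn_ord andbT geq_minr.
  + by rewrite ler_pM2l ?exprn_gt0//; exact: pe.
have := @small_ball_prob _ _ _ P _ X mX indX K Kd (level s t) (centre s t)
  (@centre_dep s t) ep ep0 l ul sl.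
move=> /le_trans; apply; rewrite lee_fin.
have -> : \prod_(e <- l) (3 * K * ep e) = \prod_(e | act e) (3 * K * ep e).
  rewrite (perm_big (seq.filter act (enum I))) ?perm_sort// big_filter.
  by rewrite big_enum_cond.
rewrite big_sumType /= [X in _ * X]big_pred0// mulr1.
apply: (@le_trans _ _ (\prod_(g : 'I_m.+1 * 'I_n.+1 * bool) (K1 * eps (level s t (inl g))))).
  rewrite big_mkcond /=; apply: ler_prod => g _; set k := level _ _ _.
  have kn : (k <= n)%N.
    rewrite -ltnS /k /level; case: (g) => [[i j] c].
    by apply: leq_ltn_trans (geq_minr _ _) (ltn_ord _).
  case: ifPn => ak; apply/andP; split.
  - by rewrite mulr_ge0 ?mulr_ge0// ltW.
  - rewrite /ep -/k mulrA ler_pM2r// /K1 -[leLHS]add0r lerD// ler_wpM2l ?mulr_ge0//.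
    by rewrite ler_weXn2l// ler1n.
  - by [].
  - have -> : eps k = 1 by apply/eqP; rewrite eq_le [1 <= _]leNgt ak andbT; have /andP[] := eps01 k.
    by rewrite mulr1.
rewrite big_split /= prodr_const !card_prod !card_ord card_bool -exprM mulnC ler_wpM2l//.
  by rewrite exprn_ge0// (le_trans ler01).
rewrite -(prod_minn_ord (fun k => eps k ^+ 2))//.
rewrite (_ : \prod_g _ = \prod_(i < m.+1) \prod_(j < n.+1) \prod_(c : bool)
    eps (level s t (inl (i, j, c)))); last first.
  rewrite pair_bigA pair_bigA /=; apply: eq_bigr => -[[i j] c] _ //.
rewrite (reindex_inj (@perm_inj _ s)) le_eqVlt; apply/orP; left; apply/eqP.
apply: eq_bigr => a _; rewrite (reindex_inj (@perm_inj _ t)); apply: eq_bigr => b _.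
by rewrite big_bool /level /= !permK expr2.
Qed.

End PivotProbability.
End GaussianPivots.

(** * Exponential equality and powers of rho *)

Section Asymptotics.
Variable R : realType.

Lemma powR_add (x a b : R) : 0 < x -> x `^ (a + b) = x `^ a * x `^ b.
Proof. by move=> x0; apply: powRD; rewrite (gt_eqF x0) implybT. Qed.

Lemma powR_ge_near (delta c : R) : 0 < delta -> \forall rho \near +oo, c <= rho `^ delta.
Proof.
move=> d0; near=> rho.
have rho0 : 0 < rho by near: rho; exact: nbhs_pinfty_gt.
have h : ((1 + `|c|) `^ delta^-1) <= rho by near: rho; apply: nbhs_pinfty_ge; exact: num_real.
have c1 : 0 <= 1 + `|c| by rewrite addr_ge0.
apply: (@le_trans _ _ (1 + `|c|)); first by apply: le_trans (ler_norm _) _; rewrite lerDr.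
rewrite -[leLHS](powRr1 c1) -(mulVf (lt0r_neq0 d0)) powRrM.
by apply: ge0_ler_powR; rewrite ?nnegrE ?powR_ge0 ?ltW.
Unshelve. all: by end_near. Qed.

Lemma ln_le_powR_near (delta c : R) : 0 < delta ->
  \forall rho \near +oo, c * ln rho <= rho `^ delta.
Proof.
move=> d0; have d2 : 0 < delta / 2 by rewrite divr_gt0.
near=> rho.
have rho0 : 0 < rho by near: rho; exact: nbhs_pinfty_gt.
have rho1 : 1 <= rho by near: rho; exact: nbhs_pinfty_ge.
have lnr : delta / 2 * ln rho <= rho `^ (delta / 2).
  by rewrite -ln_powR ltW// ln_sublinear// powR_gt0.
have ln0 : 0 <= ln rho by exact: ln_ge0.
have cr : `|c| / (delta / 2) <= rho `^ (delta / 2).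
  by near: rho; exact: powR_ge_near.
rewrite [delta in leRHS]splitr powR_add//.
apply: (@le_trans _ _ (`|c| * ln rho)); first by rewrite ler_wpM2r// ler_norm.
have -> : `|c| * ln rho = `|c| / (delta / 2) * (delta / 2 * ln rho) by rewrite mulrA divfK// gt_eqF.
by apply: ler_pM => //; [rewrite divr_ge0// ltW|rewrite mulr_ge0// ltW].
Unshelve. all: by end_near. Qed.

Lemma dot_eq_near (f : R -> R) (a delta : R) : dot_eq f a -> 0 < delta ->
  \forall rho \near +oo, rho `^ (a - delta) <= f rho <= rho `^ (a + delta).
Proof.
move=> [f0 /cvgrPdist_le fa] d0; near=> rho.
have rho1 : 1 < rho by near: rho; exact: nbhs_pinfty_gt.
have rho0 : 0 < rho by apply: lt_trans rho1.
have ln0 : 0 < ln rho by exact: ln_gt0.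
have fr : 0 < f rho by near: rho.
have : `|a - ln (f rho) / ln rho| <= delta by near: rho; exact: fa.
rewrite ler_norml => /andP[h1 h2].
have e1 : (a - delta) * ln rho <= ln (f rho) by rewrite -ler_pdivlMr//; lra.
have e2 : ln (f rho) <= (a + delta) * ln rho by rewrite -ler_pdivrMr//; lra.
by rewrite -(@ler_ln _ (rho `^ _)) ?posrE ?powR_gt0// -[f rho <= _]ler_ln ?posrE ?powR_gt0// !ln_powR e1.
Unshelve. all: by end_near. Qed.

Lemma negexpo_ge_near (p : R -> R) (c a b : R) : b < a ->
  (\forall rho \near +oo, p rho <= c * rho `^ (- a)) ->
  \forall rho \near +oo, (b%:E <= negexpo p rho)%E.
Proof.
move=> ba pc; near=> rho.
have rho1 : 1 < rho by near: rho; exact: nbhs_pinfty_gt.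
have rho0 : 0 < rho by apply: lt_trans rho1.
have ln0 : 0 < ln rho by exact: ln_gt0.
rewrite /negexpo; case: ifPn => p0; last by rewrite leey.
rewrite lee_fin ler_pdivlMr// -lerN2 opprK -mulNr -ln_powR.
rewrite ler_ln ?posrE ?powR_gt0//.
have -> : - b = (a - b) + (- a) by lra.
rewrite powR_add//; apply: (@le_trans _ _ (c * rho `^ (- a))); first by near: rho.
rewrite ler_wpM2r ?powR_ge0//; near: rho; apply: powR_ge_near; lra.
Unshelve. all: by end_near. Qed.

End Asymptotics.

(** * The optimisation problem that defines [cbar] *)

Section ExponentProgram.
Variables (R : realType) (nr nt T : nat) (r : R).

Definition layer_exponent (a : R) : R :=
  Num.max (Num.min (r / nt%:R - 1 + a) (r / nt%:R)) 0.

Lemma layer_exponent_ge0 a : 0 <= layer_exponent a.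
Proof. by rewrite /layer_exponent le_max lexx orbT. Qed.

Lemma layer_exponent_lipschitz a b e : 0 <= e -> a <= b + e ->
  layer_exponent a <= layer_exponent b + e.
Proof.
move=> e0 abe; set q := r / nt%:R.
have le0 : 0 <= layer_exponent b := layer_exponent_ge0 b.
have leb : Num.min (q - 1 + b) q <= layer_exponent b.
  by rewrite /layer_exponent le_max -/q lexx.
rewrite [leLHS]/layer_exponent -/q ge_max; apply/andP; split; last by lra.
rewrite ge_min; move: leb; have [bq leb|bq leb] := leP (q - 1 + b) q.
  by apply/orP; left; lra.
by apply/orP; right; lra.
Qed.

Lemma cbar_has_ubound (dr : R) : 0 <= r -> has_ubound
  [set v : R | exists alpha : 'I_nt -> R, @alpha_feasible R nr nt dr alpha /\
        v = \sum_(i < nt) T%:R * layer_exponent (alpha i)].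
Proof.
move=> r0; exists (\sum_(i < nt) T%:R * (r / nt%:R)) => _ [alpha [_ ->]].
apply: ler_sum => i _; rewrite ler_wpM2l// /layer_exponent ge_max ge_min lexx orbT /=.
by rewrite divr_ge0.
Qed.

Lemma cbar_ge (dr : R) (alpha : 'I_nt -> R) : 0 <= r -> @alpha_feasible R nr nt dr alpha ->
  \sum_(i < nt) T%:R * layer_exponent (alpha i) <= cbar nr nt T r dr.
Proof. by move=> r0 fa; apply: (ub_le_sup (cbar_has_ubound dr r0)); exists alpha. Qed.

Lemma cbar_ge0 (dr : R) : 0 <= r -> 0 <= cbar nr nt T r dr.
Proof.
move=> r0; have [dr0|dr0] := leP 0 dr.
  have h : @alpha_feasible R nr nt dr (fun=> 0) by split=> //; rewrite big1// => i _; rewrite mulr0.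
  apply: le_trans (cbar_ge r0 h); apply: sumr_ge0 => i _; rewrite mulr_ge0// layer_exponent_ge0 //.
(* With a negative budget the feasible set may be empty; [sup] is then 0 by default. *)
have [hs|hs] := pselect (has_sup [set v : R | exists alpha : 'I_nt -> R, @alpha_feasible R nr nt dr alpha /\
        v = \sum_(i < nt) T%:R * layer_exponent (alpha i)]); last by rewrite /cbar sup_out.
case: (hs) => -[_ [alpha [fa _]]] _; apply: le_trans (cbar_ge r0 fa).
apply: sumr_ge0 => i _; rewrite mulr_ge0// layer_exponent_ge0 //.
Qed.

(* Lowering every exponent by e, truncated at 0, restores feasibility: the
   largest exponent alone pays for e. *)
Lemma cbar_perturb (dr e : R) (alpha : 'I_nt -> R) :
  (0 < nt)%N -> (nt <= nr)%N -> 0 <= r -> 0 <= dr -> 0 <= e ->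
  @alpha_feasible R nr nt (dr + e) alpha ->
  \sum_(i < nt) T%:R * layer_exponent (alpha i) <= cbar nr nt T r dr + (nt * T)%:R * e.
Proof.
move=> nt0 ntr r0 dr0 e0 [sa ma pa].
pose beta i := Num.max (alpha i - e) 0.
have fb : @alpha_feasible R nr nt dr beta.
  split; last by move=> i; rewrite /beta le_max lexx orbT.
    (* The weight of the largest exponent is nr - nt + 1 >= 1, so lowering it by e saves at least e.
       If it is below e, then [beta] vanishes and is feasible because dr >= 0. *)
    have [ha|ha] := leP e (alpha (Ordinal nt0)).
      rewrite -(lerD2r e); apply: le_trans sa.
      rewrite (bigD1 (Ordinal nt0))//= [leRHS](bigD1 (Ordinal nt0))//= addrAC; apply: lerD.
        rewrite /beta max_l ?subr_ge0//.
        have h : (nt%:R : R) <= nr%:R by rewrite ler_nat.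
        by move: ha h; set a := alpha _; set w := nr%:R; set v := nt%:R => ha h; nra.
      apply: ler_sum => i _; rewrite ler_wpM2l//.
        have h : (nt%:R : R) <= nr%:R by rewrite ler_nat.
        have : (1 : R) <= i.+1%:R by rewrite ler1n.
        by lra.
      by rewrite /beta ge_max pa andbT gerBl.
    rewrite big1// => i _; rewrite /beta max_r ?mulr0// subr_le0.
    by apply: le_trans (ltW ha); apply: ma.
  by move=> i j ij; rewrite /beta le_max2 // ?lerB // ma.
apply: le_trans (_ : _ <= \sum_(i < nt) T%:R * (layer_exponent (beta i) + e)) _.
  apply: ler_sum => i _; rewrite ler_wpM2l//; apply: layer_exponent_lipschitz => //.
  by rewrite -lerBlDr /beta le_max lexx.
under eq_bigr do rewrite mulrDr.
rewrite big_split /= sumr_const card_ord lerD ?cbar_ge//.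
by rewrite -[leLHS]mulr_natl natrM mulrA.
Qed.

End ExponentProgram.

(** * The count at a given SNR, in terms of the pivot exponents *)

Section CountAtSNR.
Variable R : realType.
Local Notation C := (R[i]).

Lemma sd_count_powR_le m n T (D : 'I_(kappa n.+1 T) -> 'M[C]_(n.+1, T)) :
  (n <= m)%N -> ldc_gen D \in unitmx ->
  exists2 C1 : R, 0 <= C1 & forall (qr : QRfun R (T * m.+1) (kappa n.+1 T))
      (H : 'M[C]_(m.+1, n.+1)) (W : 'M[C]_(m.+1, T)) (s : 'S_m.+1) (t : 'S_n.+1)
      (eta : nat) (sy : {ffun 'I_(kappa n.+1 T) -> QI eta}) (theta xi2 rho r delta : R)
      (g : 'I_n.+1 -> R),
    (forall M, thinQR M (qr M)) -> pivoted (permuted H s t) m.+1 n.+1 ->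
    theta != 0 -> 1 <= rho -> 0 <= r -> 0 <= delta ->
    (forall k : 'I_n.+1, rho `^ (- (g k + delta) / 2) <= pivot (permuted H s t) k) ->
    Num.sqrt xi2 / `|theta| <= rho `^ ((r / n.+1%:R - 1) / 2 + delta) ->
    2 * eta%:R + 1 <= rho `^ (r / n.+1%:R / 2 + 2 * delta) ->
    1 + C1 <= rho `^ (delta / 2) ->
    (kappa n.+1 T)%:R <= rho `^ delta ->
    (sd_count qr D theta xi2 H W sy)%:R <=
      rho `^ (\sum_(i < n.+1) T%:R * layer_exponent n.+1 r (g i)
               + (4 * (n.+1 * T)%:R + 1) * delta).
Proof.
move=> nm uG; have [C1 C10 HC] := sd_layer_count nm uG; exists C1 => //.
move=> qr H W s t eta sy theta xi2 rho r delta g qrP Ap th0 rho1 r0 d0 gp xith eta_le C1_le kap_le.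
have rho0 : 0 < rho by apply: lt_le_trans rho1.
set A := permuted H s t in Ap gp *.
have piv0 (k : 'I_n.+1) : 0 < pivot A k by apply: lt_le_trans (gp k); rewrite powR_gt0.
have u0 l : (l < n.+1)%N -> schur A l l l != 0.
  move=> ln; have := piv0 (Ordinal ln); rewrite /pivot /=; apply: contraTneq => ->.
  by rewrite ComplexField.Normc.normc0 mul0r ltxx.
pose q := r / n.+1%:R; rewrite -/q in xith eta_le.
have q0 : 0 <= q by rewrite divr_ge0.
pose f i := layer_exponent n.+1 r (g i).
(* At g = 1 the exponents r/nt - 1 + g (cells) and r/nt (symbols) cross; beyond it symbols are
   cheaper. *)
pose F : {set 'I_n.+1} := finset.finset (fun i => 1 < g i).
(* Each real factor loses at most 2 delta, and there are 2T of them for each i; the final extra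
   delta of the statement absorbs the number of layers. *)
pose S := \sum_(i < n.+1) T%:R * f i + 4 * (n.+1 * T)%:R * delta.
have layer y k : (k <= kappa n.+1 T)%N ->
    #|[set sk : k.-tuple (QI eta) | partial_metric y (qr ((Complex theta 0 : C) *: (kronI T H *m ldc_gen D))).2 sk <= xi2]|%:R
      <= rho `^ S.
  move=> kkap; apply: le_trans (HC H s t theta xi2 _ y eta k F Ap u0 th0 kkap (qrP _)) _.
  have -> : rho `^ S = (\prod_(i < n.+1) rho `^ (f i / 2 + 2 * delta)) ^+ (2 * T).
    rewrite -prodrXl.
    have -> : S = \sum_(i < n.+1) (f i / 2 + 2 * delta) * (2 * T)%:R.
      rewrite /S -mulr_suml big_split /= sumr_const card_ord -mulr_suml -mulr_sumr.
      by rewrite -mulr_natr !natrM; field.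
    elim/big_rec2 : _ => [|i a b _ <-]; first by rewrite powRr0.
    by rewrite powR_add// powRrM powR_mulrn ?powR_ge0.
  rewrite mulnA (mulnC _ #|F|) [X in _ * X <= _]exprM -exprMn.
  have Y0 : 0 <= 2 * eta%:R + 1 :> R by rewrite addr_ge0 ?mulr_ge0.
  have X0 i : 0 <= 1 + C1 * (Num.sqrt xi2 / `|theta| / pivot A i).
    by rewrite addr_ge0// mulr_ge0// divr_ge0 ?pivot_ge0// divr_ge0// sqrtr_ge0.
  apply: lerXn2r; rewrite ?nnegrE.
  - by rewrite mulr_ge0 ?exprn_ge0 ?prodr_ge0.
  - by apply: prodr_ge0 => i _; exact: powR_ge0.
  rewrite -prodr_const mulrC [leRHS](bigID (mem F)) /=.
  apply: ler_pM.
  - by apply: prodr_ge0.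
  - by apply: prodr_ge0.
  - apply: ler_prod => i; rewrite inE => gi; rewrite Y0 /=; apply: le_trans eta_le _.
    rewrite ler_powR// lerD2r ler_pM2r ?invr_gt0//.
    by rewrite /f /layer_exponent -/q le_max le_min lexx andbT; apply/orP; left; lra.
  - rewrite (eq_bigl (fun i => i \notin F)); last by move=> i; rewrite inE.
    apply: ler_prod => i; rewrite inE -leNgt => gi; rewrite X0 /=.
    have qf : q - 1 + g i <= f i.
      by rewrite /f /layer_exponent -/q le_max le_min lexx /=; apply/orP; left; lra.
    have f0 : 0 <= f i by exact: layer_exponent_ge0.
    have ratio : Num.sqrt xi2 / `|theta| / pivot A i <= rho `^ (f i / 2 + 3 / 2 * delta).
      rewrite ler_pdivrMr//; apply: le_trans xith _.
      apply: (@le_trans _ _ (rho `^ (f i / 2 + 3 / 2 * delta) * rho `^ (- (g i + delta) / 2))).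
        by rewrite -powR_add// ler_powR//; lra.
      by rewrite ler_wpM2l ?powR_ge0.
    have one : 1 <= rho `^ (f i / 2 + 3 / 2 * delta).
      by rewrite -[leLHS](powRr0 rho) ler_powR//; lra.
    have -> : f i / 2 + 2 * delta = delta / 2 + (f i / 2 + 3 / 2 * delta) by lra.
    rewrite powR_add//; apply: le_trans (_ : _ <= (1 + C1) * rho `^ (f i / 2 + 3 / 2 * delta)) _.
      by rewrite mulrDl mul1r lerD// ler_wpM2l.
    by rewrite ler_wpM2r// powR_ge0.
rewrite /sd_count natr_sum.
apply: (@le_trans _ _ (\sum_(1 <= k < (kappa n.+1 T).+1) rho `^ S)).
  by rewrite big_nat [leRHS]big_nat; apply: ler_sum => k /andP[_ kk]; apply: layer.
rewrite sumr_const_nat subSS subn0 -[leLHS]mulr_natl.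
have -> : \sum_(i < n.+1) T%:R * layer_exponent n.+1 r (g i) + (4 * (n.+1 * T)%:R + 1) * delta = delta + S.
  by rewrite /S /f mulrDl mul1r; lra.
by rewrite powR_add// ler_wpM2r// powR_ge0.
Qed.

End CountAtSNR.

(** * Finite union bound *)

Section UnionBound.
Context (R : realType) (d : measure_display) (Omega : measurableType d) (P : probability Omega R).

Lemma probability_le_sum (J : finType) (A : set Omega) (E : J -> set Omega) :
  measurable A -> (forall j, measurable (E j)) -> (forall w, A w -> exists j, E j w) ->
  (P A <= \sum_j P (E j))%E.
Proof.
move=> mA mE AE.
have mU (s : seq J) : measurable (\big[setU/set0]_(j <- s) E j).
  by apply: bigsetU_measurable.
apply: (@le_trans _ _ (P (\big[setU/set0]_j E j))).
  apply: le_measure; rewrite ?inE// => w /AE[j Ej].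
  rewrite -bigcup_seq; exists j => //=; exact: mem_index_enum.
elim: (index_enum J) => [|j s IHs]; first by rewrite !big_nil measure0.
rewrite !big_cons; apply: le_trans (measureU2 _ _ _) _ => //.
by rewrite leeD2l.
Qed.

End UnionBound.

(** * Tail probability of the count *)

Section CountTail.
Variable R : realType.
Local Notation C := (R[i]).

Lemma weight_gt0 m n (k : 'I_n.+1) : (n <= m)%N -> (0 < m.+1 + n.+1 - k.*2.+1)%N.
Proof. by have := ltn_ord k; lia. Qed.

Lemma weight_rev m n (i : 'I_n.+1) : (n <= m)%N ->
  m.+1%:R - n.+1%:R + 2 * (i.+1)%:R - 1 = (m.+1 + n.+1 - (rev_ord i).*2.+1)%:R :> R.
Proof.
move=> nm; have ilt := ltn_ord i; rewrite /= subSS.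
have -> : (m.+1 + n.+1 - (n - i).*2.+1)%N = (m - n + i.*2 + 1)%N by lia.
by rewrite -muln2 !natrD natrM natrB// -![_.+1%:R]natr1; ring.
Qed.

Lemma rev_ord_antimono n (i j : 'I_n.+1) : (i <= j)%N -> (rev_ord j <= rev_ord i)%N.
Proof. by move=> ij /=; rewrite leq_sub2l. Qed.

Lemma ltr_powR_exp (a x y : R) : 1 < a -> x < y -> a `^ x < a `^ y.
Proof.
move=> a1 xy; have a0 : 0 < a by apply: lt_trans a1.
by rewrite -ltr_ln ?posrE ?powR_gt0// !ln_powR ltr_pM2r// ln_gt0.
Qed.

(** Both ends are open: j = 0 puts no upper bound on p and j = G no lower bound, so very large and
    zero pivots also receive a level. *)
Lemma grid_level (u : nat -> R) (p : R) (G : nat) :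
  exists j : 'I_G.+1, ((0 < j)%N -> p <= u j) /\ ((j < G)%N -> u j.+1 < p).
Proof.
elim: G => [|G [j [j1 j2]]]; first by exists ord0.
have [pu|up] := leP p (u G.+1); first by exists ord_max; split => //=; rewrite ltnn.
exists (widen_ord (leqnSn _) j); split => //= jG.
have [|jG'] := ltnP j G; first exact: j2.
by have -> : nat_of_ord j = G by apply/eqP; rewrite eqn_leq jG' -ltnS ltn_ord.
Qed.

Context (d : measure_display) (Omega : measurableType d) (P : probability Omega R).
Variables (m n T : nat) (H : Omega -> 'M[C]_(m.+1, n.+1)) (W : Omega -> 'M[C]_(m.+1, T)).
Variable D : 'I_(kappa n.+1 T) -> 'M[C]_(n.+1, T).

Definition grid_index (G : nat) : finType :=
  ('S_m.+1 * 'S_n.+1 * {ffun 'I_n.+1 -> 'I_G.+1})%type.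

(* The exponents -log |pivot k|^2 / log rho are rounded down to multiples of
   delta, capped at G * delta. A grid point beyond the outage budget dr + e is
   improbable; below it the count is controlled by the exponent program. *)
Lemma sd_count_tail_le : (n <= m)%N -> ldc_gen D \in unitmx -> iid_CN01 P H W ->
  exists C0 C1 : R, [/\ 0 <= C0, 0 <= C1 & forall (qr : QRfun R (T * m.+1) (kappa n.+1 T))
      (eta : nat) (sy : {ffun 'I_(kappa n.+1 T) -> QI eta})
      (theta xi2 rho r delta e dr x : R) (G : nat),
    (forall M, thinQR M (qr M)) ->
    theta != 0 -> 1 < rho -> 0 <= r -> 0 < delta -> 0 <= e -> 0 <= dr ->
    dr + e < delta * G%:R ->
    cbar m.+1 n.+1 T r dr + (n.+1 * T)%:R * e + (4 * (n.+1 * T)%:R + 1) * delta < x ->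
    Num.sqrt xi2 / `|theta| <= rho `^ ((r / n.+1%:R - 1) / 2 + delta) ->
    2 * eta%:R + 1 <= rho `^ (r / n.+1%:R / 2 + 2 * delta) ->
    1 + C1 <= rho `^ (delta / 2) ->
    (kappa n.+1 T)%:R <= rho `^ delta ->
    measurable [set w | rho `^ x <= (sd_count qr D theta xi2 (H w) (W w) sy)%:R] ->
    (P [set w | (rho `^ x <= (sd_count qr D theta xi2 (H w) (W w) sy)%:R)%R] <=
      (#|grid_index G|%:R * C0 * rho `^ (- (dr + e)))%:E)%E].
Proof.
move=> nm uG HW.
have [C1 C10 HC1] := sd_count_powR_le nm uG.
have [C0 C00 HC0] := pivots_small_ball HW nm.
exists C0, C1; split=> // qr eta sy theta xi2 rho r delta e dr x G qrP th0 rho1 r0 d0 e0 dr0 Gd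
  cx xith eta_le C1_le kap_le mN.
have rho0 : 0 < rho by apply: lt_trans rho1.
have rho1' : 1 <= rho by exact: ltW.
pose u (j : nat) := rho `^ (- (delta * j%:R) / 2).
pose wt (k : nat) : nat := (m.+1 + n.+1 - k.*2.+1)%N.
pose bad (g : {ffun 'I_n.+1 -> 'I_G.+1}) :=
  dr + e < \sum_(k < n.+1) (wt k)%:R * (delta * (g k : nat)%:R).
have wt1 (k : 'I_n.+1) : (0 < wt k)%N by exact: weight_gt0.
have /choice[E HE] : forall i : grid_index G, exists E : set Omega, [/\ measurable E,
    forall w, bad i.2 -> pivoted (permuted (H w) i.1.1 i.1.2) m.+1 n.+1 ->
      (forall k : 'I_n.+1, (0 < i.2 k)%N -> pivot (permuted (H w) i.1.1 i.1.2) k <= u (i.2 k)) -> E w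
    & (P E <= (C0 * rho `^ (- (dr + e)))%:E)%E].
  move=> [[s t] g] /=; have [bg|ng] := boolP (bad g); last first.
    exists set0; split => //; rewrite measure0 lee_fin mulr_ge0 ?powR_ge0//.
  pose eps (k : nat) := u (g (inord k)).
  have [k|E [mE EP PE]] := HC0 s t eps.
    rewrite /eps /u powR_gt0//= -[leRHS](powRr0 rho) ler_powR//.
    rewrite mulNr oppr_le0 divr_ge0// mulr_ge0// ltW//.
  exists E; split => //.
    move=> w _ Ap gp; apply: EP => // k kn; have := gp (Ordinal kn).
    rewrite /eps (_ : inord k = Ordinal kn); last by apply: val_inj; rewrite /= inordK.
    move=> h; case: (posnP (g (Ordinal kn))) => [g0|/h//].
    by rewrite /u g0 mulr0 oppr0 mul0r powRr0 ltxx.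
  apply: le_trans PE _; rewrite lee_fin ler_wpM2l//.
  have -> : \prod_(k < n.+1) (eps k ^+ 2) ^+ (m.+1 + n.+1 - k.*2.+1) =
      rho `^ (- \sum_(k < n.+1) (wt k)%:R * (delta * (g k : nat)%:R)).
    rewrite -sumrN.
    elim/big_rec2 : _ => [|k a b _ ->]; first by rewrite powRr0.
    rewrite powR_add//; congr (_ * _).
    rewrite /eps /u inord_val -exprM -powR_mulrn ?powR_ge0// -powRrM; congr (_ `^ _).
    by rewrite -/(wt k) natrM; field.
  by rewrite ler_powR// lerN2 ltW.
have mE i : measurable (E i) by case: (HE i).
apply: (@le_trans _ _ (\sum_i P (E i))%E); last first.
  apply: (@le_trans _ _ (\sum_(i : grid_index G) (C0 * rho `^ (- (dr + e)))%:E)%E).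
    by apply: lee_sum => i _; case: (HE i).
  by rewrite sumEFin lee_fin sumr_const -[leLHS]mulr_natl mulrA.
apply: probability_le_sum => // w /= Nw.
(* The permutations depend on w, which is why they belong to the index of the union. *)
have [s [t Ap]] := complete_pivoting (H w) nm.
pose A := permuted (H w) s t.
have /choice[g0 Hg0] : forall k : 'I_n.+1, exists j : 'I_G.+1,
    ((0 < j)%N -> pivot A k <= u j) /\ ((j < G)%N -> u j.+1 < pivot A k).
  by move=> k; exact: grid_level.
pose g : {ffun 'I_n.+1 -> 'I_G.+1} := [ffun k => g0 k].
have g1 k : (0 < g k)%N -> pivot A k <= u (g k) by rewrite ffunE; case: (Hg0 k).
have g2 k : (g k < G)%N -> u (g k).+1 < pivot A k by rewrite ffunE; case: (Hg0 k).
have [bg|] := boolP (bad g).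
  by exists (s, t, g); case: (HE (s, t, g)) => _ + _; apply.
rewrite -leNgt => good; exfalso.
have term0 (k : 'I_n.+1) : 0 <= (wt k)%:R * (delta * (g k : nat)%:R).
  by rewrite !mulr_ge0// ltW.
(* Within budget the cap is never reached, since weights are at least 1 and dr + e < delta G. Every
   pivot thus has a lower bound, in particular is nonzero. *)
have gG k : (g k < G)%N.
  have : delta * (g k : nat)%:R < delta * G%:R.
    apply: le_lt_trans Gd; apply: le_trans good; rewrite (bigD1 k)//=.
    apply: (@le_trans _ _ ((wt k)%:R * (delta * (g k : nat)%:R))).
      by rewrite ler_peMl ?ler1n ?wt1// mulr_ge0// ltW.
    by rewrite lerDl sumr_ge0.
  by rewrite ltr_pM2l// ltr_nat.
have u_anti i j : (i <= j)%N -> u j <= u i.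
  move=> ij; rewrite /u ler_powR// !mulNr lerN2 ler_pM2r ?invr_gt0// ler_pM2l// ler_nat//.
(* Rounding preserves the order of the pivots, so the rounded exponents, reversed, satisfy the
   ordering constraint of the program. *)
have gmono (k l : 'I_n.+1) : (k <= l)%N -> (g k <= g l)%N.
  move=> kl; rewrite leqNgt; apply/negP => lt_lk.
  have p1 := g1 k (leq_ltn_trans (leq0n _) lt_lk).
  have p2 := g2 l (gG l).
  have p3 : pivot A l <= pivot A k by apply: (pivot_nonincreasing Ap) => //; rewrite kl ltn_ord.
  by have := u_anti _ _ lt_lk; move: p1 p2 p3; lra.
have gp (k : 'I_n.+1) : rho `^ (- (delta * (g k : nat)%:R + delta) / 2) <= pivot A k.
  apply: le_trans (ltW (g2 k (gG k))); rewrite /u le_eqVlt; apply/orP; left; apply/eqP.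
  by rewrite -[(g k).+1%:R]natr1 mulrDr mulr1.
have hN := HC1 qr (H w) (W w) s t eta sy theta xi2 rho r delta (fun k => delta * (g k : nat)%:R)
  qrP Ap th0 rho1' r0 (ltW d0) gp xith eta_le C1_le kap_le.
have := le_trans Nw hN; apply/negP; rewrite -ltNge.
pose alpha (i : 'I_n.+1) := delta * (g (rev_ord i) : nat)%:R.
have fa : @alpha_feasible R m.+1 n.+1 (dr + e) alpha.
  split.
  - apply: le_trans good; rewrite [leRHS](reindex_inj rev_ord_inj) /=; apply: ler_sum => i _.
    by rewrite weight_rev.
  - by move=> i j ij; rewrite /alpha ler_pM2l// ler_nat gmono// rev_ord_antimono.
  - by move=> i; rewrite /alpha mulr_ge0// ltW.
have := @cbar_perturb R m.+1 n.+1 T r dr e alpha isT nm r0 dr0 e0 fa.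
rewrite (reindex_inj rev_ord_inj) /=; under eq_bigr do rewrite /alpha rev_ordK.
by move=> hc; apply: ltr_powR_exp => //; lra.
Qed.

End CountTail.

(** * Averaging over the symbols, and conclusion *)

Section Averages.
Context (R : realType) (d : measure_display) (Omega : measurableType d) (P : probability Omega R).

Lemma prob_s_le (k eta : nat) (E : {ffun 'I_k -> QI eta} -> set Omega) (b : R) :
  (forall s, measurable (E s)) -> (forall s, (P (E s) <= b%:E)%E) -> prob_s P E <= b.
Proof.
move=> mE Eb; rewrite /prob_s.
have card0 : (0 < #|{: {ffun 'I_k -> QI eta}}|)%N.
  by apply/card_gt0P; exists [ffun=> qdef eta].
rewrite ler_pdivrMl ?ltr0n//.
apply: (@le_trans _ _ (\sum_(s : {ffun 'I_k -> QI eta}) b)).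
  by apply: ler_sum => s _; rewrite -lee_fin fineK// fin_num_measure.
by rewrite sumr_const mulr_natl.
Qed.

End Averages.

Lemma sphere_radius_le (R : realType) (rho q delta xi2 theta : R) :
  0 < rho -> theta != 0 -> xi2 <= rho `^ delta -> rho `^ (1 - q - delta) <= theta ^+ 2 ->
  Num.sqrt xi2 / `|theta| <= rho `^ ((q - 1) / 2 + delta).
Proof.
move=> rho0 th0 xi th; have thp : 0 < `|theta| by rewrite normr_gt0.
rewrite ler_pdivrMr//; set B := rho `^ _.
have B0 : 0 <= B by exact: powR_ge0.
rewrite -[leRHS]ger0_norm ?mulr_ge0// -sqrtr_sqr ler_wsqrtr//.
apply: le_trans xi _; rewrite exprMn real_normK ?num_real//.
have -> : B ^+ 2 = rho `^ (q - 1 + 2 * delta).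
  by rewrite /B -powR_mulrn ?powR_ge0// -powRrM; congr (_ `^ _); field.
rewrite [delta in leLHS](_ : _ = (q - 1 + 2 * delta) + (1 - q - delta)); last by ring.
by rewrite [leLHS]powR_add// ler_wpM2l ?powR_ge0.
Qed.

Theorem theorem2 (R : realType) (nr nt T : nat) (r : R)
  (d : measure_display) (Omega : measurableType d) (P : probability Omega R)
  (H : Omega -> 'M[R[i]]_(nr, nt)) (W : Omega -> 'M[R[i]]_(nr, T))
  (D : 'I_(kappa nt T) -> 'M[R[i]]_(nt, T))
  (eta : R -> nat) (theta : R -> R)
  (qr : QRfun R (T * nr) (kappa nt T))
  (dr z : R) (Psi : R -> \bar R) :
  (0 < nt)%N -> (0 < T)%N -> (nt <= nr)%N ->
  0 <= r <= nt%:R ->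
  (* channel statistics *)
  iid_CN01 P H W ->
  (* full rate linear dispersive code: G full rank *)
  ldc_gen D \in unitmx ->
  (* eta = rho^{rT/(2 kappa)}, theta^2 = rho^{1 - rT/kappa} (exponential equality) *)
  dot_eq (fun rho => (eta rho)%:R) (r * T%:R / (2 * (kappa nt T)%:R)) ->
  dot_eq (fun rho => theta rho ^+ 2) (1 - r * T%:R / (kappa nt T)%:R) ->
  (* qr returns a thin QR decomposition *)
  (forall M, thinQR M (qr M)) ->
  (* d(r) is the diversity gain of ML decoding (the limit exists and equals dr) *)
  negexpo (fun rho => prob_s P (fun s : {ffun 'I_(kappa nt T) -> QI (eta rho)} =>
      [set w | ml_error D (theta rho) (H w) (W w) s])) @ +oo%R --> dr%:E ->
  (* radius xi^2 = z log2 rho with z > d(r) *)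
  dr < z ->
  (* N is a random variable *)
  (forall (rho x : R) (s : {ffun 'I_(kappa nt T) -> QI (eta rho)}),
      measurable [set w | rho `^ x <=
        (sd_count qr D (theta rho) (z * (ln rho / ln 2)) (H w) (W w) s)%:R]) ->
  (* Psi(x) = - lim log Pr(N >= rho^x) / log rho (the limits exist) *)
  (forall x : R, negexpo (fun rho => prob_s P (fun s : {ffun 'I_(kappa nt T) -> QI (eta rho)} =>
      [set w | rho `^ x <=
        (sd_count qr D (theta rho) (z * (ln rho / ln 2)) (H w) (W w) s)%:R]))
      @ +oo%R --> Psi x) ->
  (* c(r) = inf {x | Psi(x) > d(r)} <= \bar c(r) *)
  inf [set x : R | (dr%:E < Psi x)%E] <= cbar nr nt T r dr.
Proof.
case: nt H D qr => // n H D qr _ T0; case: nr H W qr => // m H W qr nm /andP[r0 _] HW uG.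
have T0' : T%:R != 0 :> R by rewrite pnatr_eq0 -lt0n.
have n0' : n.+1%:R != 0 :> R by rewrite pnatr_eq0.
set q := r / n.+1%:R.
have q0 : 0 <= q by rewrite divr_ge0.
have cancelT (a b : R) : a != 0 -> b != 0 -> r * a / (a * b) = r / b.
  by move=> a0 b0; field; rewrite a0 b0.
have -> : r * T%:R / (2 * (kappa n.+1 T)%:R) = q / 2.
  by rewrite invfM mulrCA mulrC /kappa natrM cancelT.
have -> : 1 - r * T%:R / (kappa n.+1 T)%:R = 1 - q by rewrite /kappa natrM cancelT.
move=> Heta Htheta qrP _ drz mN PsiP.
set c := cbar _ _ _ _ _.
have c0 : 0 <= c by exact: cbar_ge0.
suff key x : c < x -> (dr%:E < Psi x)%E.
  (* Without an infimum, [inf] is 0 by default, and c >= 0. *)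
  have [hi|hi] := pselect (has_inf [set x : R | (dr%:E < Psi x)%E]); last by rewrite inf_out.
  apply/ler_addgt0Pr => e e0; apply: (ge_inf hi.2); apply: key; lra.
move=> cx.
pose N rho (w : Omega) (s : {ffun 'I_(kappa n.+1 T) -> QI (eta rho)}) :=
  sd_count qr D (theta rho) (z * (ln rho / ln 2)) (H w) (W w) s.
suff [a [b [dra Pb]]] : exists a b : R, dr < a /\ \forall rho \near +oo, forall s,
    (P [set w | (rho `^ x <= (N rho w s)%:R)%R] <= (b * rho `^ (- a))%:E)%E.
  pose a' := (dr + a) / 2.
  apply: (@lt_le_trans _ _ a'%:E); first by rewrite lte_fin /a'; lra.
  apply: (cvge_to_ge (PsiP x)); apply: (@negexpo_ge_near _ _ b a); first by rewrite /a'; lra.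
  near=> rho; apply: prob_s_le => [s|]; first exact: mN.
  by near: rho.
(* For negative dr the trivial bound 1, of exponent 0, is already enough. *)
have [dr0|dr0] := ltP dr 0.
  exists 0, 1; split => //; near=> rho => s.
  by rewrite oppr0 powRr0 mulr1; apply: probability_le1; exact: mN.
have [C0 [C1 [C00 C10 HC]]] := sd_count_tail_le (nm : (n <= m)%N) uG HW.
pose M : R := (n.+1 * T)%:R.
have M0 : 0 <= M by [].
(* The budget slack and the rounding each use at most a quarter of the gap x - c. *)
pose e := (x - c) / (4 * (M + 1)); pose delta := (x - c) / (4 * (4 * M + 1)).
have e0 : 0 < e by rewrite /e divr_gt0 ?mulr_gt0//; lra.
have d0 : 0 < delta by rewrite /delta divr_gt0 ?mulr_gt0//; lra.
have Me : M * e <= (x - c) / 4.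
  have : (M + 1) * e = (x - c) / 4 by rewrite /e; field; lra.
  by nra.
have Md : (4 * M + 1) * delta = (x - c) / 4 by rewrite /delta; field; lra.
pose G := (Num.truncn ((dr + e) / delta)).+1.
have Gd : dr + e < delta * G%:R.
  by rewrite mulrC -ltr_pdivrMr// truncnS_gt.
exists (dr + e), (#|grid_index m n G|%:R * C0); split; first by lra.
have d2 : 0 < delta / 2 by lra.
near=> rho => s.
have rho1 : 1 < rho by near: rho; exact: nbhs_pinfty_gt.
have rho0 : 0 < rho by apply: lt_trans rho1.
have th0 : theta rho != 0.
  rewrite -sqrf_eq0 gt_eqF//; near: rho; exact: Htheta.1.
have /andP[th1 _] : rho `^ (1 - q - delta) <= theta rho ^+ 2 <= rho `^ (1 - q + delta).
  by near: rho; exact: dot_eq_near.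
have /andP[_ eta1] : rho `^ (q / 2 - delta) <= (eta rho)%:R <= rho `^ (q / 2 + delta).
  by near: rho; exact: dot_eq_near.
apply: (HC qr (eta rho) s (theta rho) (z * (ln rho / ln 2)) rho r delta e dr x G) => //.
- exact: ltW.
- by rewrite -/M -/c; lra.
(* The radius z log rho, in base 2, is a constant times [ln rho], hence below rho^delta. *)
- apply: sphere_radius_le => //; rewrite mulrCA mulrC; near: rho.
  exact: ln_le_powR_near.
- rewrite -/q; have three : 3 <= rho `^ delta by near: rho; exact: powR_ge_near.
  have one : 1 <= rho `^ (q / 2 + delta).
    by rewrite -[leLHS](powRr0 rho) ler_powR// ?ltW//; lra.
  have -> : q / 2 + 2 * delta = delta + (q / 2 + delta) by lra.
  rewrite powR_add//; apply: (@le_trans _ _ (3 * rho `^ (q / 2 + delta))); first by lra.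
  by rewrite ler_wpM2r// powR_ge0.
- by near: rho; exact: powR_ge_near.
- by near: rho; exact: powR_ge_near.
Unshelve. all: by end_near. Qed.
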